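(* Let $T$ be the two-sorted theory of $c$-nilpotent Lie algebras defined in the context (the model companion of $T_0$). Then $T$ is not approximable by structures of finite Morley rank; that is, no model $\mathcal M\models T$ is approximated by a directed system of substructures of $\mathcal M$ each of which has finite Morley rank.
   Context: **The theory.** $\mathcal L_{vs}$ is two-sorted with sorts $V$ and $K$: on $V$ a constant $0_V$, binary functions $+_V,-_V$, and for each $n$ an $n$-ary relation $\theta_n$; on $K$ the language of rings; a function $\cdot:K\times V\to V$; and functions $\pi_{n,i}:V^{n+1}\to K$. $\mathcal L_{K,V,c}$ extends $\mathcal L_{vs}$ by a binary function $[\cdot,\cdot]:V^2\to V$ and unary predicates $P_1,\dots,P_{c+1}$ on $V$. $T_0$ says: $K$ is a field; $V$ is a $K$-vector space with scalar multiplication $\cdot$; $\theta_n(v_1,\dots,v_n)$ holds iff $v_1,\dots,v_n$ are linearly independent; if they are linearly independent and $w=\sum_i\alpha_iv_i$ then $\pi_{n,i}(v_1,\dots,v_n,w)=\alpha_i$, otherwise $\pi_{n,i}(v_1,\dots,v_n,w)=0$; $[\cdot,\cdot]$ is an alternating $K$-bilinear map satisfying the Jacobi identity; each $P_i$ defines a vector subspace of $V$ and $(P_i(V))_{1\le i\le c+1}$ is a Lazard series: $V=P_1(V)\supseteq P_2(V)\supseteq\dots\supseteq P_c(V)\supseteq P_{c+1}(V)=0$ and $[P_i(V),P_j(V)]\subseteq P_{i+j}(V)$ for all $1\le i,j\le c+1$, where $P_{m}(V)=0$ for $m>c$. $T$ is the model companion of $T_0$. **Approximation.** Let $\mathcal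 H$ be a directed system (under inclusion) of substructures of $\mathcal M$; $\bar A=\mathrm{acl}^{\mathcal M}(A)$. $\psi(a)$ is *eventually true* in $\mathcal H$ if there is $\mathcal N\in\mathcal H$ containing $a$ with $\mathcal N'\models\psi(a)$ for all $\mathcal N\subseteq\mathcal N'\in\mathcal H$. A formula or finite partial type $\pi(x,b)$ *eventually forks* (resp. eventually does not fork) over $C$ if there is $\mathcal N\in\mathcal H$ containing $b$ such that for all $\mathcal N\subseteq\mathcal N'\in\mathcal H$, $\pi(x,b)$ forks (resp. does not fork) over $C\cap N'$ in $\mathcal N'$. $A\perp^{\lim}_C B$ means: for each finite $a\in A$ there is $\mathcal N\in\mathcal H$ containing $a$ such that for all $\mathcal N\subseteq\mathcal N'\in\mathcal H$, $\mathrm{tp}^{\mathcal N'}(a/(\bar B\cup\bar C)\cap N')$ does not fork over $\bar C\cap N'$ in $\mathcal N'$. $\mathcal H$ *approximates* $\mathcal M$ if: (1) $\bigcup\mathcal H=\mathcal M$; (2) $\mathcal H$ is closed under automorphisms of $\mathcal M$; (3) (convergence of truth value) if $\mathcal M\models\psi(a)$ then $\psi(a)$ is eventually true in $\mathcal H$; (4) every $\pi(x,b)$ and $C$ satisfy that $\pi(x,b)$ eventually forks or eventually does not fork over $C$; (5) if $A\not\perp^{\lim}_C B$, there are a parameter-free $\varphi(x,y,z)$ and $a\in A,b\in\bar B,c\in\bar C$ with $\mathcal M\models\varphi(a,b,c)$ and $\varphi(x,b,c)$ eventually forking over $\bar C$.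
   Formalization: The formal theorem assumes c ≥ 2; for c = 0 (V = 0) and c = 1 (abelian: infinite-dimensional vector spaces over algebraically closed fields) the models are approximable by structures of finite Morley rank, so the claim is false there. *)

(* Defs.v *)
(* Subsets are [Prop]-valued predicates: the [set] of MathComp-Analysis lives in
   a universe strictly below that of [finType], which rules out sets of formulas
   in finite contexts. *)
From mathcomp Require Import all_boot.

Set Implicit Arguments.
Unset Strict Implicit.
Unset Printing Implicit Defensive.

(** * Many-sorted first-order logic *)

(* A finite family of sorted variables.  Contexts serve as arities of symbols,
   as the free variables of a formula, and as the shape of finite tuples. *)
Record ctx (S : Type) := Ctx { cvar : finType; csort : cvar -> S }.

Definition cnil S : ctx S := @Ctx S void (of_void S).
Definition cone S (s : S) : ctx S := @Ctx S unit (fun=> s).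
Definition cpow S (s : S) (n : nat) : ctx S := @Ctx S 'I_n (fun=> s).
Definition cpair S (s t : S) : ctx S := @Ctx S bool (fun b => if b then s else t).
Definition cext S (G : ctx S) (s : S) : ctx S :=
  @Ctx S (option (cvar G)) (fun o => if o is Some x then csort x else s).
Definition ccat S (G D : ctx S) : ctx S :=
  @Ctx S (cvar G + cvar D)%type
    (fun z => match z with inl x => csort x | inr y => csort y end).

(* [tup X G] is the type of tuples of shape [G] in the sorted family [X]. *)
Definition tup S (X : S -> Type) (G : ctx S) := forall x : cvar G, X (csort x).

Definition tnil S (X : S -> Type) : tup X (cnil S) :=
  fun x => match x with end.
Definition tone S (X : S -> Type) s (a : X s) : tup X (cone s) := fun=> a.
Definition tpair S (X : S -> Type) s t (a : X s) (b : X t) : tup X (cpair s t) :=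
  fun i => if i as i0 return X (if i0 then s else t) then a else b.
Definition text S (X : S -> Type) (G : ctx S) s (v : tup X G) (a : X s) :
    tup X (cext G s) :=
  fun o => match o as o0 return X (if o0 is Some x then csort x else s) with
           | Some x => v x | None => a end.
Definition tcat S (X : S -> Type) (G D : ctx S) (a : tup X G) (b : tup X D) :
    tup X (ccat G D) :=
  fun z => match z as z0
             return X (match z0 with inl x => csort x | inr y => csort y end) with
           | inl x => a x | inr y => b y end.
Definition tmap S (X Y : S -> Type) (f : forall s, X s -> Y s) (G : ctx S)
  (a : tup X G) : tup Y G := fun x => f _ (a x).

Record language := Language {
  sort : Type;
  func : Type;
  fdom : func -> ctx sort;
  fcod : func -> sort;
  rel : Type;
  rdom : rel -> ctx sort }.

Inductive term (L : language) (G : ctx (sort L)) : sort L -> Type :=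
| tvar (x : cvar G) : term G (csort x)
| tapp (f : func L) (args : forall i : cvar (fdom f), term G (csort i)) :
    term G (fcod f).

(* [fall s p] quantifies the variable [None] of [cext G s].  The remaining
   connectives are classically definable. *)
Inductive formula (L : language) (G : ctx (sort L)) : Type :=
| fbot
| feq (s : sort L) (t u : term G s)
| frel (r : rel L) (args : forall i : cvar (rdom r), term G (csort i))
| fimp (p q : formula G)
| fall (s : sort L) (p : formula (cext G s)).

Definition sentence (L : language) := formula (cnil (sort L)).

Record structure (L : language) := Structure {
  carrier :> sort L -> Type;
  fint : forall f : func L, tup carrier (fdom f) -> carrier (fcod f);
  rint : forall r : rel L, tup carrier (rdom r) -> Prop }.

Section Logic.
Variable L : language.
Implicit Types (M N : structure L) (G D : ctx (sort L)).

Fixpoint eval M G (v : tup M G) s (t : term G s) : M s :=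
  match t in term _ s0 return M s0 with
  | tvar x => v x
  | tapp f args => fint (fun i => eval v (args i))
  end.

Fixpoint sat M G (p : formula G) : tup M G -> Prop :=
  match p with
  | fbot => fun=> False
  | feq _ t u => fun v => eval v t = eval v u
  | frel r args => fun v => rint (fun i => eval v (args i))
  | fimp p1 p2 => fun v => sat p1 v -> sat p2 v
  | fall s p1 => fun v => forall a : M s, sat p1 (text v a)
  end.

Definition theory := sentence L -> Prop.
Definition models M (T : theory) := forall p, T p -> sat p (@tnil _ M).

(** ** Embeddings, model companions *)

Definition embedding M N (e : forall s, M s -> N s) :=
  [/\ forall s, injective (e s),
      forall (f : func L) (a : tup M (fdom f)), e _ (fint a) = fint (tmap e a)
    & forall (r : rel L) (a : tup M (rdom r)), rint a <-> rint (tmap e a)].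

Definition automorphism M (e : forall s, M s -> M s) :=
  embedding e /\ forall s, bijective (e s).

Definition elementary M N (e : forall s, M s -> N s) :=
  forall G (p : formula G) (a : tup M G), sat p a <-> sat p (tmap e a).

Definition model_complete (T : theory) :=
  forall M N (e : forall s, M s -> N s),
    models M T -> models N T -> embedding e -> elementary e.

(* [K] is the class of models of a theory; being its model companion only
   depends on that class. *)
Definition model_companion (K : structure L -> Prop) (T : theory) :=
  [/\ forall M, K M -> exists N (e : forall s, M s -> N s),
        models N T /\ embedding e,
      forall M, models M T -> exists N (e : forall s, M s -> N s),
        K N /\ embedding e
    & model_complete T].

(** ** Sorted subsets, parameters, algebraic closure *)

Definition sset M := forall s, M s -> Prop.
Definition tin M (A : sset M) G (a : tup M G) := forall x, A _ (a x).
Definition ssetU M (A B : sset M) : sset M := fun s x => A s x \/ B s x.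
Definition simage M N (e : forall s, M s -> N s) (A : sset M) : sset N :=
  fun s y => exists2 x, A s x & e s x = y.

(* A formula in the variables [G] with a finite tuple of parameters in [M]. *)
Record pformula M G := PFormula {
  pctx : ctx (sort L);
  pform : formula (ccat G pctx);
  ppar : tup M pctx }.
Arguments ppar {M G} p x.

Definition psat M G (p : pformula M G) (a : tup M G) :=
  sat (pform p) (tcat a (ppar p)).

Definition pmap M N (e : forall s, M s -> N s) G (p : pformula M G) :
  pformula N G := PFormula (pform p) (tmap e (ppar p)).

Definition finite_pred (X : Type) (P : X -> Prop) :=
  exists n (f : 'I_n -> X), forall x, P x -> exists i, f i = x.

Definition acl M (A : sset M) : sset M := fun s a =>
  exists p : pformula M (cone s),
    [/\ tin A (ppar p), psat p (tone a)
      & finite_pred (fun b : M s => psat p (tone b))].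

Definition tp M G (a : tup M G) (B : sset M) : pformula M G -> Prop :=
  fun p => tin B (ppar p) /\ psat p a.

(** ** Forking

    Elementary extensions of [N] play the role of a monster model. *)

(* [d'] in [N'] realizes the image under [e] of the type of [d] over [C]. *)
Definition same_type M N (e : forall s, M s -> N s) (C : sset M) G
    (d : tup M G) (d' : tup N G) :=
  forall p : pformula M G, tin C (ppar p) -> (psat p d <-> psat (pmap e p) d').

Definition divides N (C : sset N) G (p : pformula N G) :=
  exists (N' : structure L) (e : forall s, N s -> N' s)
         (d : nat -> tup N' (pctx p)) (k : nat),
    [/\ elementary e, 0 < k,
        forall i, same_type e C (ppar p) (d i)
      & forall h : 'I_k -> nat, injective h ->
          ~ exists a : tup N' G, forall j, sat (pform p) (tcat a (d (h j)))].

Definition forks N (C : sset N) G (Pi : pformula N G -> Prop) :=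
  exists (N' : structure L) (e : forall s, N s -> N' s)
         (n : nat) (q : 'I_n -> pformula N' G),
    [/\ elementary e,
        forall j, divides (simage e C) (q j)
      & forall (N'' : structure L) (e' : forall s, N' s -> N'' s) (a : tup N'' G),
          elementary e' ->
          (forall p, Pi p -> psat (pmap e' (pmap e p)) a) ->
          exists j, psat (pmap e' (q j)) a].

(** ** Morley rank *)

Definition definable M G (D : tup M G -> Prop) :=
  exists p : pformula M G, forall a, D a <-> psat p a.

(* "The Morley rank of [D] is at least [n]", for a definable set [D] of an
   aleph_0-saturated structure. *)
Fixpoint morley_rank_ge M G (n : nat) (D : tup M G -> Prop) : Prop :=
  match n with
  | 0 => exists a, D a
  | n'.+1 => exists E : nat -> tup M G -> Prop,
      (forall i j a, E i a -> E j a -> i = j) /\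
      forall i, [/\ definable (E i), forall a, E i a -> D a
                  & morley_rank_ge n' (E i)]
  end.

Definition aleph0_saturated M :=
  forall s D (b : tup M D) (p : formula (ccat (cone s) D) -> Prop),
    (forall n (q : 'I_n -> formula (ccat (cone s) D)), (forall i, p (q i)) ->
       exists a : M s, forall i, sat (q i) (tcat (tone a) b)) ->
    exists a : M s, forall q, p q -> sat q (tcat (tone a) b).

(* Every sort has finite Morley rank, computed as usual in an
   aleph_0-saturated elementary extension. *)
Definition finite_morley_rank N :=
  exists (N' : structure L) (e : forall s, N s -> N' s),
    [/\ elementary e, aleph0_saturated N'
      & forall s, exists n, ~ morley_rank_ge n (fun _ : tup N' (cone s) => True)].

(** ** Substructures and approximation *)

Record substructure M := Substructure {
  sdom : sset M;
  sdom_closed : forall (f : func L) (a : tup M (fdom f)),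
    tin sdom a -> sdom (fint a) }.

Definition induced M (N : substructure M) : structure L :=
  @Structure L (fun s => {x : M s | sdom N x})
    (fun f a => exist _ (fint (tmap (fun s => @proj1_sig _ (@sdom _ N s)) a))
       (@sdom_closed M N f _ (fun i => proj2_sig (a i))))
    (fun r a => rint (tmap (fun s => @proj1_sig _ (@sdom _ N s)) a)).

Definition ssub M (A B : sset M) := forall s x, A s x -> B s x.

(* The intersection of [C] and [N], as a subset of the structure induced on [N] *)
Definition trace M (N : substructure M) (C : sset M) : sset (induced N) :=
  fun s x => C s (proj1_sig x).
Arguments trace {M} N C s x.

Definition lift M (N : substructure M) G (a : tup M G) (ha : tin (sdom N) a) :
  tup (induced N) G := fun x => exist _ (a x) (ha x).

Section Approximation.
Variables (M : structure L) (H : substructure M -> Prop).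

(* [P N' _] holds for all members [N'] of [H] above some member containing [a] *)
Definition eventually G (a : tup M G)
    (P : forall N' : substructure M, tin (sdom N') a -> Prop) :=
  exists N : substructure M, [/\ H N, tin (sdom N) a &
    forall (N' : substructure M) (ha : tin (sdom N') a),
      H N' -> ssub (sdom N) (sdom N') -> P N' ha].

Definition eventually_true G (p : formula G) (a : tup M G) :=
  @eventually G a (fun (N' : substructure M) ha => sat p (lift ha)).

(* the finite partial type {q_i(x, b) | i < n}, read in [N'] *)
Definition finite_type (N' : substructure M) G D n
    (q : 'I_n -> formula (ccat G D)) (b : tup M D) (hb : tin (sdom N') b) :
    pformula (induced N') G -> Prop :=
  fun p => exists i, p = PFormula (q i) (lift hb).

Definition eventually_forks (C : sset M) G D n
    (q : 'I_n -> formula (ccat G D)) (b : tup M D) :=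
  @eventually D b (fun (N' : substructure M) hb =>
    forks (trace N' C) (finite_type q hb)).

Definition eventually_not_forks (C : sset M) G D n
    (q : 'I_n -> formula (ccat G D)) (b : tup M D) :=
  @eventually D b (fun (N' : substructure M) hb =>
    ~ forks (trace N' C) (finite_type q hb)).

Definition indep_lim (A C B : sset M) :=
  forall G (a : tup M G), tin A a ->
    @eventually G a (fun (N' : substructure M) ha =>
      ~ forks (trace N' (acl C))
          (tp (lift ha) (trace N' (ssetU (acl B) (acl C))))).

Definition directed :=
  forall N1 N2 : substructure M, H N1 -> H N2 ->
    exists N3 : substructure M,
      [/\ H N3, ssub (sdom N1) (sdom N3) & ssub (sdom N2) (sdom N3)].

Record approximates : Prop := Approximates {
  approx_directed : directed;
  approx_union : forall s (x : M s), exists2 N : substructure M, H N & sdom N x;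
  approx_aut : forall e, automorphism e ->
    forall N : substructure M, H N ->
    exists2 N' : substructure M,
      H N' & forall s x, sdom N' x <-> @simage M M e (sdom N) s x;
  approx_truth : forall G (p : formula G) (a : tup M G),
    sat p a -> eventually_true p a;
  approx_forking : forall G D n (q : 'I_n -> formula (ccat G D)) (b : tup M D)
      (C : sset M),
    eventually_forks C q b \/ eventually_not_forks C q b;
  approx_witness : forall A B C : sset M, ~ indep_lim A C B ->
    exists G D E (p : formula (ccat G (ccat D E)))
           (a : tup M G) (b : tup M D) (c : tup M E),
      [/\ tin A a, tin (acl B) b, tin (acl C) c,
          sat p (tcat a (tcat b c))
        & eventually_forks (acl C) (fun _ : 'I_1 => p) (tcat b c)] }.

End Approximation.
End Logic.
Arguments ppar {L M G} p x.
Arguments trace {L M} N C s x.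

(** * The two-sorted language and theory of c-nilpotent Lie algebras *)

Inductive lsort := sV | sK.

Inductive lfunc :=
| fzeroV | faddV | fsubV
| fzeroK | foneK | faddK | foppK | fmulK
| fscale
| fpi (n : nat) (i : 'I_n)
| fbracket.

(* [rlaz i] is the predicate [P_{i+1}], for [0 <= i <= c] *)
Inductive lrel (c : nat) :=
| rtheta (n : nat)
| rlaz (i : 'I_c.+1).

(* In the domain [V^(n+1)] of [fpi i] the last argument is the variable [None]. *)
Definition lfdom (f : lfunc) : ctx lsort :=
  match f with
  | fzeroV | fzeroK | foneK => cnil lsort
  | faddV | fsubV | fbracket => cpair sV sV
  | faddK | fmulK => cpair sK sK
  | foppK => cone sK
  | fscale => cpair sK sV
  | @fpi n _ => cext (cpow sV n) sV
  end.

Definition lfcod (f : lfunc) : lsort :=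
  match f with
  | fzeroV | faddV | fsubV | fscale | fbracket => sV
  | _ => sK
  end.

Definition lrdom c (r : lrel c) : ctx lsort :=
  match r with rtheta n => cpow sV n | rlaz _ => cone sV end.

Definition LKV (c : nat) : language := Language lfdom lfcod (@lrdom c).

Section LieTheory.
Variables (c : nat) (M : structure (LKV c)).

Definition zeroV : M sV := @fint _ M fzeroV (@tnil _ M).
Definition addV (v w : M sV) : M sV := @fint _ M faddV (tpair v w).
Definition subV (v w : M sV) : M sV := @fint _ M fsubV (tpair v w).
Definition zeroK : M sK := @fint _ M fzeroK (@tnil _ M).
Definition oneK : M sK := @fint _ M foneK (@tnil _ M).
Definition addK (a b : M sK) : M sK := @fint _ M faddK (tpair a b).
Definition oppK (a : M sK) : M sK := @fint _ M foppK (tone a).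
Definition mulK (a b : M sK) : M sK := @fint _ M fmulK (tpair a b).
Definition scale (a : M sK) (v : M sV) : M sV := @fint _ M fscale (tpair a v).
Definition bracket (v w : M sV) : M sV := @fint _ M fbracket (tpair v w).
Definition pi n (i : 'I_n) (v : 'I_n -> M sV) (w : M sV) : M sK :=
  @fint _ M (fpi i) (@text _ M (cpow sV n) sV v w).
Definition theta n (v : 'I_n -> M sV) : Prop := @rint _ M (rtheta c n) v.

(* [laz m] is [P_m(V)] for [m >= 1].  For [m > c] it is [P_{c+1}(V)], which the
   theory requires to be 0. *)
Definition laz (m : nat) (v : M sV) : Prop :=
  @rint _ M (rlaz (inord (minn m c.+1).-1)) (@tone _ M sV v).

Definition lincomb n (a : 'I_n -> M sK) (v : 'I_n -> M sV) : M sV :=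
  \big[addV/zeroV]_(i < n) scale (a i) (v i).

Definition lin_indep n (v : 'I_n -> M sV) :=
  forall a : 'I_n -> M sK, lincomb a v = zeroV -> forall i, a i = zeroK.

Record field_axioms : Prop := FieldAxioms {
  addKA : associative addK;
  addKC : commutative addK;
  add0K : left_id zeroK addK;
  addNK : left_inverse zeroK oppK addK;
  mulKA : associative mulK;
  mulKC : commutative mulK;
  mul1K : left_id oneK mulK;
  mulKDl : left_distributive mulK addK;
  oneK_neq0 : oneK <> zeroK;
  mulVK : forall a, a <> zeroK -> exists b, mulK b a = oneK }.

Record vector_space_axioms : Prop := VectorSpaceAxioms {
  addVA : associative addV;
  addVC : commutative addV;
  add0V : left_id zeroV addV;
  subVK : forall v w, addV (subV v w) w = v;
  scaleA : forall a b v, scale a (scale b v) = scale (mulK a b) v;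
  scale1 : forall v, scale oneK v = v;
  scaleDr : forall a v w, scale a (addV v w) = addV (scale a v) (scale a w);
  scaleDl : forall a b v, scale (addK a b) v = addV (scale a v) (scale b v) }.

Record coordinate_axioms : Prop := CoordinateAxioms {
  thetaP : forall n (v : 'I_n -> M sV), theta v <-> lin_indep v;
  pi_indep : forall n (v : 'I_n -> M sV) (a : 'I_n -> M sK),
    lin_indep v -> forall i, pi i v (lincomb a v) = a i;
  pi_default : forall n (v : 'I_n -> M sV) (w : M sV),
    ~ (lin_indep v /\ exists a, w = lincomb a v) -> forall i, pi i v w = zeroK }.

Record lie_axioms : Prop := LieAxioms {
  bracket_alt : forall v, bracket v v = zeroV;
  bracketDl : forall u v w, bracket (addV u v) w = addV (bracket u w) (bracket v w);
  bracketDr : forall u v w, bracket w (addV u v) = addV (bracket w u) (bracket w v);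
  bracketZl : forall a v w, bracket (scale a v) w = scale a (bracket v w);
  bracketZr : forall a v w, bracket v (scale a w) = scale a (bracket v w);
  jacobi : forall u v w,
    addV (bracket u (bracket v w))
      (addV (bracket v (bracket w u)) (bracket w (bracket u v))) = zeroV }.

Definition subspace (W : M sV -> Prop) :=
  [/\ W zeroV, forall v w, W v -> W w -> W (addV v w)
    & forall a v, W v -> W (scale a v)].

Record lazard_axioms : Prop := LazardAxioms {
  laz_subspace : forall i, 1 <= i <= c.+1 -> subspace (laz i);
  laz_first : forall v, laz 1 v;
  laz_decr : forall i, 1 <= i <= c -> forall v, laz i.+1 v -> laz i v;
  laz_last : forall v, laz c.+1 v <-> v = zeroV;
  laz_bracket : forall i j, 1 <= i <= c.+1 -> 1 <= j <= c.+1 ->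
    forall v w, laz i v -> laz j w -> laz (i + j) (bracket v w) }.

(* [M] is a model of the theory T_0 of c-nilpotent Lie algebras over a field,
   with a Lazard series *)
Record models_T0 : Prop := ModelsT0 {
  T0_field : field_axioms;
  T0_vector_space : vector_space_axioms;
  T0_coordinates : coordinate_axioms;
  T0_lie : lie_axioms;
  T0_lazard : lazard_axioms }.

End LieTheory.

(* [M] is approximated by a directed system of substructures of finite Morley
   rank. *)
Definition approximable_by_fmr L (M : structure L) :=
  exists H : substructure M -> Prop,
    approximates H /\ forall N, H N -> finite_morley_rank (induced N).

(* Main.v *)
(* Only the convergence of truth values is used.  Since [M] is existentially
   closed among the models of [T_0], it satisfies a single sentence [rich], which
   passes to some [N] in the approximating system and to its saturated elementary
   extension [N'], and which has no model of finite Morley rank.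

   It says that [x^2 = x + a] is always solvable, so that [K(N')] is infinite and
   a finite Morley rank forces [V(N')] to be finite-dimensional.  For [t] outside
   [P_2] it also says that the bilinear map [b(v, u) = [v, ad_t^(c-2) u]], from
   [V/P_2 x V/P_2] to [P_c], is so generic that for [v1] outside [P_2], any [v2]
   and any [w] in [P_c] there is [u] with [b(v1, u) = w] and [b(v2, u)] a multiple
   of [w].  Let [l1, l2] be functionals dual to independent [p, q] in [P_c].  The
   form [l1 o b] is nondegenerate on the left, hence, in finite dimension, some
   [v2] satisfies [l1 b(v2, .) = l2 b(t, .)].  But there is [u] with [b(t, u) = q]
   and [b(v2, u)] a multiple of [q]: the left side vanishes at [u] and the right
   side is [1].

   For the genericity of [M], choose a functional [k] with kernel containing [P_2]
   and nonzero at [t] and [v1], and adjoin vectors [u_(c-2)], ..., [u_0] one by one,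
   [u_i] in [P_(i+1)], with [[v, u_i] = k(v) u_(i+1)] and [u_(c-1)] a multiple of
   [w].  Then [b(v, u_0)] is [k(v)] times a fixed multiple of [w]. *)

From HB Require Import structures.
From mathcomp Require Import all_boot all_algebra ring zify.
From mathcomp Require Import boolp classical_sets.
Require Import Defs.

Set Implicit Arguments.
Unset Strict Implicit.
Unset Printing Implicit Defensive.

Import GRing.Theory.

(** * Uniform definability *)

Section Definability.
Variable L : language.
Implicit Types (M N : structure L) (G D : ctx (Defs.sort L)).

Definition is_term G s (t : forall M, tup M G -> M s) :=
  exists p : term G s, forall M (v : tup M G), eval v p = t M v.

(* The meaning [P] ranges over all structures at once, so an expressible property
   transfers along elementary maps and along the approximation. *)
Definition expressible G (P : forall M, tup M G -> Prop) :=
  exists p : formula G, forall M (v : tup M G), sat p v <-> P M v.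

Fixpoint tlift G s r (t : term G r) : term (cext G s) r :=
  match t in term _ r0 return term (cext G s) r0 with
  | tvar x => @tvar L (cext G s) (Some x)
  | tapp f args => tapp (fun i => tlift s (args i))
  end.

Lemma eval_tlift M G s r (t : term G r) (v : tup M (cext G s)) :
  eval v (tlift s t) = eval (fun x : cvar G => v (Some x)) t.
Proof.
elim: t => //= f args IH.
by congr fint; apply: functional_extensionality_dep => i; apply: IH.
Qed.

Lemma is_term_var G (x : cvar G) : is_term (fun M (v : tup M G) => v x).
Proof. by exists (@tvar L G x). Qed.

Lemma is_term_eval G s (t : term G s) : is_term (fun M (v : tup M G) => eval v t).
Proof. by exists t. Qed.

Lemma expressible_iff G (P Q : forall M, tup M G -> Prop) :
  (forall M v, P M v <-> Q M v) -> expressible P -> expressible Q.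
Proof. by move=> PQ [p pP]; exists p => M v; rewrite pP PQ. Qed.

Lemma expressible_false G : expressible (fun M (_ : tup M G) => False).
Proof. by exists (fbot G). Qed.

Lemma expressible_eq G s (t u : forall M, tup M G -> M s) :
  is_term t -> is_term u -> expressible (fun M v => t M v = u M v).
Proof. by move=> [p pt] [q qu]; exists (feq p q) => M v /=; rewrite pt qu. Qed.

Lemma expressible_imp G (P Q : forall M, tup M G -> Prop) :
  expressible P -> expressible Q -> expressible (fun M v => P M v -> Q M v).
Proof. by move=> [p pP] [q qQ]; exists (fimp p q) => M v /=; rewrite pP qQ. Qed.

Lemma expressible_all G s (P : forall M, tup M G -> M s -> Prop) :
  expressible (fun M (v : tup M (cext G s)) =>
    P M (fun x : cvar G => v (Some x)) (v None)) ->
  expressible (fun M v => forall a : M s, P M v a).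
Proof.
by move=> [p pP]; exists (fall p) => M v /=; split=> h a;
  [exact: (proj1 (pP M (text v a)) (h a)) | exact: (proj2 (pP M (text v a)) (h a))].
Qed.

Lemma expressible_not G (P : forall M, tup M G -> Prop) :
  expressible P -> expressible (fun M v => ~ P M v).
Proof. by move=> fP; apply: expressible_imp fP (expressible_false G). Qed.

Lemma expressible_and G (P Q : forall M, tup M G -> Prop) :
  expressible P -> expressible Q -> expressible (fun M v => P M v /\ Q M v).
Proof.
move=> fP fQ; apply: (@expressible_iff _ (fun M v => ~ (P M v -> ~ Q M v))).
  move=> M v; split=> [|[p q] /(_ p)]; last by apply.
  by move=> h; split; apply: contrapT => n; apply: h.
by apply/expressible_not/expressible_imp => //; apply: expressible_not.
Qed.

Lemma expressible_ex G s (P : forall M, tup M G -> M s -> Prop) :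
  expressible (fun M (v : tup M (cext G s)) =>
    P M (fun x : cvar G => v (Some x)) (v None)) ->
  expressible (fun M v => exists a : M s, P M v a).
Proof.
move=> fP.
apply: (@expressible_iff _ (fun M v => ~ (forall a : M s, ~ P M v a))).
  by move=> M v; split=> [/existsNP[a /contrapT]|[a Pa] /(_ a)]; [exists a|].
by apply/expressible_not/expressible_all/expressible_not.
Qed.

Lemma expressible_definable G D (P : forall M, tup M (ccat G D) -> Prop) M
    (b : tup M D) :
  expressible P -> definable (fun a : tup M G => P M (tcat a b)).
Proof. by move=> [p pP]; exists (PFormula p b) => a; rewrite -pP. Qed.

End Definability.

(** * Terms and atomic formulas of the language of Lie algebras *)

Section LieDefinability.
Variable c : nat.
Implicit Types (M N : structure (LKV c)) (G : ctx lsort).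
Local Notation is_term := (@is_term (LKV c) _ _).
Local Notation expressible := (@expressible (LKV c) _).

Section Terms.
Variable G : ctx lsort.

Lemma tpair_eval M (v : tup M G) s t (p : term (L := LKV c) G s) (q : term (L := LKV c) G t) :
  (fun i : cvar (cpair s t) => eval v
    (if i as i0 return term (L := LKV c) G (if i0 then s else t) then p else q))
  = tpair (eval v p) (eval v q).
Proof. by apply: functional_extensionality_dep => -[]. Qed.

Lemma is_term_zeroV : is_term (fun M (_ : tup M G) => zeroV M).
Proof.
exists (@tapp (LKV c) G fzeroV (fun i : cvar (@lfdom fzeroV) => match i with end)).
move=> M v; apply: (congr1 (@fint (LKV c) M fzeroV)).
by apply: functional_extensionality_dep => -[].
Qed.

Lemma is_term_zeroK : is_term (fun M (_ : tup M G) => zeroK M).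
Proof.
exists (@tapp (LKV c) G fzeroK (fun i : cvar (@lfdom fzeroK) => match i with end)).
move=> M v; apply: (congr1 (@fint (LKV c) M fzeroK)).
by apply: functional_extensionality_dep => -[].
Qed.

Lemma is_term_oneK : is_term (fun M (_ : tup M G) => oneK M).
Proof.
exists (@tapp (LKV c) G foneK (fun i : cvar (@lfdom foneK) => match i with end)).
move=> M v; apply: (congr1 (@fint (LKV c) M foneK)).
by apply: functional_extensionality_dep => -[].
Qed.

(** For a concrete symbol [E] is [erefl] and the cast computes away, so one proof with [f] abstract
    serves all six binary operations. *)
Let binary (f : lfunc) s r (E : lfdom f = cpair s r) (t : forall M, tup M G -> M s)
    (u : forall M, tup M G -> M r) :
  is_term t -> is_term u ->
  is_term (fun M v => @fint (LKV c) M f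
    (eq_rect_r (fun D => tup M D) (tpair (t M v) (u M v)) E)).
Proof.
move=> [p pt] [q qu].
exists (@tapp (LKV c) G f (eq_rect_r (fun D => forall i : cvar D, term (L := LKV c) G (csort i))
  (fun i : cvar (cpair s r) =>
     if i as i0 return term (L := LKV c) G (if i0 then s else r) then p else q) E)).
move=> M v; apply: (congr1 (@fint (LKV c) M f)); rewrite -pt -qu -tpair_eval.
by move: E => /=; move: (lfdom f) => D E; subst D.
Qed.

Lemma is_term_addV (t u : forall M, tup M G -> M sV) :
  is_term t -> is_term u -> is_term (fun M v => addV (t M v) (u M v)).
Proof. exact: (@binary faddV sV sV erefl). Qed.
Lemma is_term_subV (t u : forall M, tup M G -> M sV) :
  is_term t -> is_term u -> is_term (fun M v => subV (t M v) (u M v)).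
Proof. exact: (@binary fsubV sV sV erefl). Qed.
Lemma is_term_bracket (t u : forall M, tup M G -> M sV) :
  is_term t -> is_term u -> is_term (fun M v => bracket (t M v) (u M v)).
Proof. exact: (@binary fbracket sV sV erefl). Qed.
Lemma is_term_addK (t u : forall M, tup M G -> M sK) :
  is_term t -> is_term u -> is_term (fun M v => addK (t M v) (u M v)).
Proof. exact: (@binary faddK sK sK erefl). Qed.
Lemma is_term_mulK (t u : forall M, tup M G -> M sK) :
  is_term t -> is_term u -> is_term (fun M v => mulK (t M v) (u M v)).
Proof. exact: (@binary fmulK sK sK erefl). Qed.
Lemma is_term_scale (t : forall M, tup M G -> M sK) (u : forall M, tup M G -> M sV) :
  is_term t -> is_term u -> is_term (fun M v => scale (t M v) (u M v)).
Proof. exact: (@binary fscale sK sV erefl). Qed.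

Lemma is_term_oppK (t : forall M, tup M G -> M sK) :
  is_term t -> is_term (fun M v => oppK (t M v)).
Proof. by move=> [p pt]; exists (@tapp (LKV c) G foppK (fun=> p)) => M v; rewrite -pt. Qed.

Lemma is_term_iter n (f : forall M, tup M G -> M sV -> M sV) (t : forall M, tup M G -> M sV) :
  (forall u : forall M, tup M G -> M sV, is_term u -> is_term (fun M v => f M v (u M v))) ->
  is_term t -> is_term (fun M v => iter n (f M v) (t M v)).
Proof. by move=> ff ft; elim: n => //= n IH; apply: ff. Qed.

Lemma expressible_laz m (t : forall M, tup M G -> M sV) :
  is_term t -> expressible (fun M v => laz m (t M v)).
Proof.
move=> [p pt].
exists (@frel (LKV c) G (rlaz (inord (minn m c.+1).-1)) (fun=> p)) => M v.
by rewrite -pt.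
Qed.

Lemma expressible_theta n (t : 'I_n -> forall M, tup M G -> M sV) :
  (forall i, is_term (t i)) -> expressible (fun M v => theta (fun i => t i M v)).
Proof.
move=> /choice[p pt].
exists (@frel (LKV c) G (rtheta c n) p) => M v.
rewrite /theta /=.
by have -> : (fun i => eval v (p i)) = (fun i => t i M v)
  by apply: functional_extensionality_dep => i; exact: pt.
Qed.

End Terms.
End LieDefinability.

(** * Models as vector spaces *)

(* Aliases of the two sorts: the proofs they carry are what allows the MathComp
   structures to be inferred. *)
Definition scalars c (M : structure (LKV c)) of field_axioms M := M sK.
Definition vectors c (M : structure (LKV c)) (fa : field_axioms M)
  of vector_space_axioms M := M sV.

Section Pack.
Local Open Scope ring_scope.
Variables (c : nat) (M : structure (LKV c)) (fa : field_axioms M).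
Local Notation F := (scalars fa).

(** The inverse is chosen classically; the default [a] is reached only at zero and gives the
    MathComp convention [0^-1 = 0]. *)
Definition invK (a : M sK) : M sK :=
  if pselect (a <> zeroK M) is left h then projT1 (cid (mulVK fa h)) else a.

HB.instance Definition _ := gen_eqMixin F.
HB.instance Definition _ := gen_choiceMixin F.
HB.instance Definition _ :=
  GRing.isZmodule.Build F (addKA fa) (addKC fa) (add0K fa) (addNK fa).
Let oneK_neq0' : (oneK M : F) != (zeroK M : F).
Proof. by apply/eqP; exact: oneK_neq0 fa. Qed.
HB.instance Definition _ := GRing.Zmodule_isComNzRing.Build F
  (mulKA fa) (mulKC fa) (mul1K fa) (mulKDl fa) oneK_neq0'.
Let invKP (a : F) : a != 0 -> (invK a : F) * a = 1.
Proof.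
move=> /eqP a0; rewrite /invK; case: pselect => // h.
by case: cid.
Qed.
Let invK0 : (invK (zeroK M) : F) = 0.
Proof. by rewrite /invK; case: pselect. Qed.
HB.instance Definition _ := GRing.ComNzRing_isField.Build F invKP invK0.

Variable va : vector_space_axioms M.
Local Notation V := (vectors fa va).
HB.instance Definition _ := gen_eqMixin V.
HB.instance Definition _ := gen_choiceMixin V.
Let oppV (v : V) : V := subV (zeroV M) v.
Let addNV : left_inverse (zeroV M : V) oppV (@addV c M).
Proof. by move=> v; apply: subVK va _ _. Qed.
HB.instance Definition _ :=
  GRing.isZmodule.Build V (addVA va) (addVC va) (add0V va) addNV.
Let scaleDl' (v : V) : {morph (fun a : F => scale a v : V) : a b / a + b}.
Proof. by move=> a b; exact: scaleDl va a b v. Qed.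
HB.instance Definition _ := GRing.Zmodule_isLmodule.Build F V
  (scaleA va) (scale1 va) (scaleDr va) scaleDl'.

Lemma subVE (v w : V) : subV v w = v - w.
Proof. by apply: (@addIr _ w); rewrite subrK; apply: (subVK va). Qed.

Lemma lincombE n (a : 'I_n -> F) (v : 'I_n -> V) :
  lincomb a v = \sum_i a i *: v i.
Proof. by []. Qed.

End Pack.

(** * Linear algebra *)

Section Functional.
Local Open Scope ring_scope.
Variables (F : fieldType) (V : lmodType F).

Definition linear_subspace (W : V -> Prop) :=
  W 0 /\ forall a v w, W v -> W w -> W (a *: v + w).

Lemma linear_subspaceN W v : linear_subspace W -> W v -> W (- v).
Proof. by move=> [W0 WD] Wv; rewrite -scaleN1r -[_ *: _]addr0; apply: WD. Qed.

Lemma linear_subspaceB W v w : linear_subspace W -> W v -> W w -> W (v - w).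
Proof.
move=> sW Wv Ww; rewrite -[v]scale1r; apply: sW.2 => //.
exact: linear_subspaceN.
Qed.

Lemma linear_subspaceD W v w : linear_subspace W -> W v -> W w -> W (v + w).
Proof. by move=> sW Wv Ww; rewrite -[v]scale1r; apply: sW.2. Qed.

Lemma linear_subspaceZ W a v : linear_subspace W -> W v -> W (a *: v).
Proof. by move=> sW Wv; rewrite -[_ *: _]addr0; apply: sW.2 => //; case: sW. Qed.

(** Zorn's lemma gives [U] maximal among the subspaces that contain [W] and avoid [v]. If some [u]
    were not a multiple of [v] modulo [U], then [U + F u] would still avoid [v], against maximality.
    So [U] is a complement of the line of [v]. *)
Lemma maximal_avoiding_subspace (W : V -> Prop) (v : V) :
  linear_subspace W -> ~ W v ->
  exists U : V -> Prop, [/\ linear_subspace U, forall w, W w -> U w, ~ U v &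
    forall u, exists a, U (u - a *: v)].
Proof.
move=> sW nWv.
pose good (U : V -> Prop) := [/\ linear_subspace U, forall w, W w -> U w & ~ U v].
pose T := {U : V -> Prop | good U}.
pose R (s t : T) : bool := `[< forall u, sval s u -> sval t u >].
have gW : good W by [].
have [||||[U gU] maxU] := @Zorn T R.
- by move=> t; apply/asboolP.
- by move=> r s t /asboolP rs /asboolP st; apply/asboolP => u /rs /st.
- move=> [s gs] [t gt] /asboolP /= st /asboolP /= ts.
  have E : s = t by apply: funext => u; apply: propext; split=> [/st|/ts].
  by subst t; congr exist; apply: Prop_irrelevance.
(* The union bounds a nonempty chain, and [W] bounds the empty one. *)
- move=> A totA.
  have [[t0 At0]|nA] := pselect (exists t, A t); last first.
    by exists (exist _ W gW) => s As; case: nA; exists s.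
  pose U u := exists2 t : T, A t & sval t u.
  have gU : good U.
    split.
    - split; first by exists t0 => //; case: (svalP t0) => -[].
      move=> a u w [s As su] [t At tw].
      have [/asboolP st|/asboolP ts] := totA _ _ As At.
      + by exists t => //; case: (svalP t) => -[_ tD] _ _; apply: tD => //; apply: st.
      + by exists s => //; case: (svalP s) => -[_ tD] _ _; apply: tD => //; apply: ts.
    - by move=> w Ww; exists t0 => //; case: (svalP t0) => _ h _; apply: h.
    - by move=> [t At]; case: (svalP t).
  by exists (exist _ U gU) => s As; apply/asboolP => u su; exists s.
case: (gU) => sU WU nUv; exists U; split=> // u.
apply: contrapT => nu.
have nUu : ~ U u by move=> Uu; apply: nu; exists 0; rewrite scale0r subr0.
pose U' x := exists b, U (x - b *: u).
have gU' : good U'.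
  split.
  - split; first by exists 0; rewrite scale0r subr0; case: sU.
    move=> a x y [b Ub] [d Ud]; exists (a * b + d).
    rewrite scalerDl opprD addrACA -scalerA -scalerBr.
    by apply: sU.2.
  - by move=> w /WU Uw; exists 0; rewrite scale0r subr0.
  - move=> [b Ub]; apply: nu; exists b^-1.
    have b0 : b != 0.
      by apply/eqP => b0; move: Ub; rewrite b0 scale0r subr0.
    rewrite -[u - _]opprK opprB -[u in _ - u](scale1r) -(mulVf b0) -scalerA -scalerBr.
    by apply: linear_subspaceN => //; apply: linear_subspaceZ.
have UU' : R (exist _ U gU) (exist _ U' gU').
  by apply/asboolP => x /= Ux; exists 0; rewrite scale0r subr0.
have /(congr1 sval) /= E := maxU _ UU'.
apply: nUu; rewrite -E; exists 1; rewrite scale1r subrr; exact: sU.1.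
Qed.

(** [k u] is the coefficient of [v] when [u] is decomposed along [U] and the line of [v]. The
    coefficient is unique because [U] avoids [v], and uniqueness makes the chosen function
    linear. *)
Lemma separating_functional (W : V -> Prop) (v : V) :
  linear_subspace W -> ~ W v ->
  exists k : V -> F, [/\ linear_for *%R k, forall w, W w -> k w = 0 & k v = 1].
Proof.
move=> sW nWv.
have [U [sU WU nUv /choice[k kP]]] := maximal_avoiding_subspace sW nWv.
have uniq_k u a : U (u - a *: v) -> k u = a.
  move=> Ua; apply/eqP; rewrite -subr_eq0; apply: contrapT => /negP ka0; apply: nUv.
  rewrite -[v]scale1r -(mulVf ka0) -scalerA; apply: linear_subspaceZ => //.
  have -> : (k u - a) *: v = (u - a *: v) - (u - k u *: v).
    by rewrite scalerBl opprB [RHS]addrC addrA subrK.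
  exact: linear_subspaceB.
exists k; split.
- move=> a u w; apply: uniq_k.
  by rewrite scalerDl opprD addrACA -scalerA -scalerBr; apply: sU.2.
- by move=> w /WU Uw; apply: uniq_k; rewrite scale0r subr0.
- by apply: uniq_k; rewrite scale1r subrr; case: sU.
Qed.

End Functional.

(** * Span, freeness and bilinear forms modulo a subspace *)

Section Span.
Local Open Scope ring_scope.
Variables (F : fieldType) (V : lmodType F) (W : V -> Prop).
Hypothesis sW : linear_subspace W.

(** Span in the quotient [V/W], handled through representatives. The recursion gives one scalar
    quantifier per vector, in the same shape as [spanned], its counterpart inside a structure of the
    language. *)
Fixpoint span_mod (us : seq V) (v : V) : Prop :=
  if us is u :: us' then exists x : F, span_mod us' (v - x *: u) else W v.

Fixpoint free_mod (us : seq V) : Prop :=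
  if us is u :: us' then ~ span_mod us' u /\ free_mod us' else True.

Lemma span_mod_subspace us : linear_subspace (span_mod us).
Proof.
elim: us => //= u us IH; split; first by exists 0; rewrite scale0r subr0; case: IH.
move=> a v w [x vx] [y wy]; exists (a * x + y).
by rewrite scalerDl opprD addrACA -scalerA -scalerBr; apply: IH.2.
Qed.

Lemma span_modP us v : span_mod us v <->
  exists r : 'I_(size us) -> F, W (v - \sum_i r i *: us`_i).
Proof.
elim: us v => /= [|u us IH] v.
  split=> [Wv|[r]]; last by rewrite big_ord0 subr0.
  by exists (fun=> 0); rewrite big_ord0 subr0.
split=> [[x /IH[r Wr]]|[r]].
  exists (fun i => oapp r x (unlift ord0 i)).
  rewrite big_ord_recl /= unlift_none /= opprD addrA.
  by under eq_bigr => i _ do rewrite liftK /=.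
rewrite big_ord_recl /= opprD addrA => Wr.
by exists (r ord0); apply/IH; exists (fun i => r (fintype.lift ord0 i)).
Qed.

Lemma free_modP us (r : 'I_(size us) -> F) :
  free_mod us -> W (\sum_i r i *: us`_i) -> forall i, r i = 0.
Proof.
elim: us r => /= [|u us IH] r; first by move=> _ _ [].
move=> [nu fus]; rewrite big_ord_recl /= => Wr.
have r0 : r ord0 = 0.
  apply: contrapT => /eqP r0; apply: nu.
  rewrite -[u]scale1r -(mulVf r0) -scalerA.
  apply: linear_subspaceZ; first exact: span_mod_subspace.
  apply/span_modP; exists (fun i => - r (fintype.lift ord0 i)).
  by under eq_bigr => i _ do rewrite scaleNr; rewrite sumrN opprK.
move=> i; case: (unliftP ord0 i) => [j|] -> //.
by move: Wr; rewrite r0 scale0r add0r => /(IH (fun j => r (fintype.lift ord0 j))); apply.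
Qed.

(** A vector already in the span of those kept after it is dropped; any other is kept. *)
Lemma free_spanning us : exists us', free_mod us' /\
  forall v, span_mod us v -> span_mod us' v.
Proof.
elim: us => [|u us [us' [f_us' sub]]]; first by exists [::].
have [su|nsu] := pselect (span_mod us' u).
  exists us'; split=> // v /= [x /sub sv].
  rewrite -[v](subrK (x *: u)).
  by apply: (linear_subspaceD (span_mod_subspace _)) => //;
     apply: (linear_subspaceZ _ (span_mod_subspace _)).
by exists (u :: us'); split=> //= v [x /sub sv]; exists x.
Qed.

Lemma free_or_spanning :
  (exists us, forall v, span_mod us v) \/ (forall n, exists2 us, size us = n & free_mod us).
Proof.
have [|nex] := pselect (exists us, forall v, span_mod us v); [by left|right].
elim=> [|n [us <- fus]]; first by exists [::].
have [v nv] : exists v, ~ span_mod us v.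
  by apply: contrapT => h; apply: nex; exists us => v; apply: contrapT => nv; apply: h; exists v.
by exists (v :: us).
Qed.

(** Let [B] be the Gram matrix of [phi] in a basis of [V] modulo [W]. A row [r] with [r B = 0] holds
    the coordinates of a vector in the left kernel of [phi], that is in [W], so it is zero by
    freeness. Hence [B] is invertible, and solving [r B = psi] gives the coordinates of [v]. *)
Lemma nondegenerate_representation (phi : V -> V -> F) (psi : V -> F) us :
  (forall v, span_mod us v) ->
  (forall u, linear_for *%R (phi^~ u)) -> (forall v, linear_for *%R (phi v)) ->
  linear_for *%R psi ->
  (forall v u, W u -> phi v u = 0) -> (forall u, W u -> psi u = 0) ->
  (forall v, (forall u, phi v u = 0) -> W v) ->
  exists v, forall u, phi v u = psi u.
Proof.
move=> sp; have [us' [fus sub]] := free_spanning us.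
have spus v : span_mod us' v by apply/sub/sp.
move: us' {sp sub} fus spus => {}us fus spus lphi rphi lpsi phiW psiW nd.
pose d := size us.
have sumE (k : V -> F) (r : 'I_d -> F) : linear_for *%R k ->
    k (\sum_i r i *: us`_i) = \sum_i r i * k us`_i.
  move=> lk; have k0 : k 0 = 0.
    by have := lk 1 0 0; rewrite scaler0 addr0 mul1r => /esym/eqP; rewrite -subr_eq0 addrK => /eqP.
  by elim/big_rec2: _ => // i x y _ <-; rewrite lk.
have vanish (k : V -> F) : linear_for *%R k -> (forall u, W u -> k u = 0) ->
    (forall i : 'I_d, k us`_i = 0) -> forall u, k u = 0.
  move=> lk kW k0 u; have /span_modP[r /kW] := spus u.
  have -> x y : k (x - y) = k x - k y.
    by rewrite addrC -scaleN1r lk mulN1r addrC.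
  by rewrite sumE // big1 ?subr0 // => i _; rewrite k0 mulr0.
pose B : 'M[F]_d := \matrix_(i, j) phi us`_i us`_j.
have B_unit : B \in unitmx.
  rewrite -row_free_unit; apply: inj_row_free => r rB0.
  apply/rowP => i; rewrite mxE; apply: (free_modP (r := r 0) fus _ i).
  apply: nd; apply: vanish => // [u Wu|j]; first exact: phiW.
  rewrite (sumE (phi^~ _)) //.
  have /rowP/(_ j) := rB0; rewrite !mxE => {2}<-.
  by apply: eq_bigr => k _; rewrite mxE.
pose r := (\row_j psi us`_j) *m invmx B.
have rB : r *m B = \row_j psi us`_j by rewrite mulmxKV.
exists (\sum_i r 0 i *: us`_i) => u; apply/eqP; rewrite -subr_eq0; apply/eqP; move: u.
apply: (vanish (fun u => phi _ u - psi u)).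
- by move=> a u w; rewrite rphi lpsi opprD addrACA mulrBr.
- by move=> u Wu; rewrite phiW // psiW // subrr.
- move=> j; rewrite (sumE (phi^~ _)) //.
  have /rowP/(_ j) := rB; rewrite !mxE => <-; apply/eqP; rewrite subr_eq0; apply/eqP.
  by apply: eq_bigr => k _; rewrite [B _ _]mxE.
Qed.

End Span.

(** * Morley rank of an infinite-dimensional space *)

Section InfiniteField.
Local Open Scope ring_scope.

Lemma infinite_sequence (T : eqType) :
  (forall s : seq T, exists x, x \notin s) -> exists a : nat -> T, injective a.
Proof.
move=> /choice[next nextP].
pose s n := iter n (fun s => next s :: s) [::].
have next_in i j : (i < j)%N -> next (s i) \in s j.
  elim: j => // j IH; rewrite ltnS leq_eqVlt inE => /predU1P[->|/IH ->].
    by rewrite eqxx.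
  by rewrite orbT.
exists (fun n => next (s n)) => i j E; case: (ssrnat.ltngtP i j) => // /next_in.
  by rewrite E (negPf (nextP _)).
by rewrite -E (negPf (nextP _)).
Qed.

(* [x^2 - x] takes the value 0 twice, so it cannot permute a finite field. *)
Lemma artin_schreier_infinite (F : fieldType) :
  (forall a : F, exists x, x * x = x + a) -> exists a : nat -> F, injective a.
Proof.
move=> AS; apply: infinite_sequence => s; apply: contrapT => ns.
have cov x : x \in undup s.
  by rewrite mem_undup; apply: contrapT => /negP xs; apply: ns; exists x.
pose f (x : F) := x * x - x.
(* Since [f 1 = f 0], the map [f] is still onto after [1] is removed, so the list of all elements
   would be no longer than the list without [1]. *)
have : (size (undup s) <= size (map f (rem (1 : F)%R (undup s))))%N.
  apply: uniq_leq_size => [|y _]; first exact: undup_uniq.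
  have [x xx] := AS y.
  have fx : f x = y by rewrite /f xx addrC addKr.
  have [x1|x1] := eqVneq x 1.
    apply/mapP; exists 0; last by rewrite -fx x1 /f mulr0 mul1r !subrr.
    by rewrite (rem_filter 1 (undup_uniq s)) mem_filter cov /= eq_sym oner_eq0.
  apply/mapP; exists x => //.
  by rewrite (rem_filter 1 (undup_uniq s)) mem_filter cov /= x1.
rewrite size_map size_rem; last exact: cov.
by case: (undup s) (cov 0) => //= ? ? _; rewrite ltnn.
Qed.

End InfiniteField.

Section Rank.
Local Open Scope ring_scope.
Variable c : nat.
Implicit Types M : structure (LKV c).

(** This is read in an arbitrary structure, without the vector space axioms; for a list of terms it
    is then a formula with one quantifier over [K] per vector. *)
Fixpoint spanned M (us : seq (M sV)) (v : M sV) : Prop :=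
  if us is u :: us' then exists x : M sK, spanned us' (subV v (scale x u))
  else v = zeroV M.

Lemma expressible_spanned (G : ctx lsort) (ts : seq (term (L := LKV c) G sV))
    (t : term (L := LKV c) G sV) :
  expressible (fun M (v : tup M G) => spanned (map (@eval _ _ _ v sV) ts) (eval v t)).
Proof.
suff gen (u : forall M, tup M G -> M sV) : is_term u ->
    expressible (fun M (v : tup M G) => spanned (map (@eval _ _ _ v sV) ts) (u M v)).
  by apply: gen; exists t.
have [n] := ubnP (size ts); elim: n G ts {t} u => // n IH G [|t ts] u /= ltn fu.
  exact: expressible_eq fu (is_term_zeroV _ _).
apply: expressible_ex => /=.
have [p pu] := fu.
have : @expressible (LKV c) (cext G sK) (fun M v =>
  spanned (map (@eval _ _ _ v sV) (map (@tlift (LKV c) G sK sV) ts))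
    (subV (eval v (@tlift (LKV c) G sK sV p))
      (scale (v None) (eval v (@tlift (LKV c) G sK sV t))))).
  apply: IH; rewrite ?size_map //; apply: is_term_subV; first exact: is_term_eval.
  by apply: is_term_scale; [exact: (@is_term_var (LKV c) (cext G sK) None) | exact: is_term_eval].
apply: expressible_iff => M v; rewrite !eval_tlift pu -map_comp.
rewrite (@eq_map _ _ _ (@eval (LKV c) M G (fun x => v (Some x)) sV)) // => s.
exact: eval_tlift.
Qed.

Lemma spanned_definable M (us : seq (M sV)) (w : M sV) :
  definable (fun a : tup M (cone sV) => spanned us (subV (a tt) w)).
Proof.
pose n := size us.
pose G := ccat (cone sV) (cpow sV n.+1).
pose t (i : 'I_n.+1) : term (L := LKV c) G sV := @tvar (LKV c) G (inr i).
have [p pP] : expressible (fun M (v : tup M G) =>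
    spanned (map (@eval _ _ _ v sV) [seq t (fintype.lift ord0 i) | i <- enum 'I_n])
      (subV (v (inl tt)) (v (inr ord0)))).
  have [q qP] : @is_term (LKV c) G sV (fun M v => subV (v (inl tt)) (v (inr ord0))).
    by apply: is_term_subV; [exact: (@is_term_var (LKV c) G (inl tt))
                           | exact: (@is_term_var (LKV c) G (inr ord0))].
  apply: (@expressible_iff _ _ (fun M (v : tup M G) =>
    spanned (map (@eval _ _ _ v sV) [seq t (fintype.lift ord0 i) | i <- enum 'I_n]) (eval v q))).
    by move=> N v; rewrite qP.
  exact: expressible_spanned.
(* Parameter [0] is [w], and parameter [i + 1] is the vector of index [i] in [us]. *)
pose b : tup M (cpow sV n.+1) := fun i => nth (zeroV M) (w :: us) i.
have := expressible_definable b (ex_intro _ p pP).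
move=> [q qP]; exists q => a; rewrite -qP /= -map_comp.
suff -> : [seq nth (zeroV M) us (i : 'I_n) | i <- enum 'I_n] = us by [].
by rewrite (map_comp (nth (zeroV M) us) val) val_enum_ord map_nth_iota0 // take_size.
Qed.

Lemma morley_rank_ge_sub M G n (D D' : tup M G -> Prop) :
  (forall a, D a -> D' a) -> morley_rank_ge n D -> morley_rank_ge n D'.
Proof.
case: n => [|n] DD' /=; first by move=> [a /DD']; exists a.
by move=> [E [Edisj EP]]; exists E; split=> // i; have [dE ED rE] := EP i; split=> // a /ED /DD'.
Qed.

Variables (M : structure (LKV c)) (fa : field_axioms M) (va : vector_space_axioms M).
Local Notation F := (scalars fa).
Local Notation V := (vectors fa va).

Lemma spannedE (us : seq V) (v : V) : @spanned M us v <-> span_mod (eq^~ 0) us v.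
Proof.
elim: us v => [|u us IH] v //=.
split=> -[x h]; exists x.
  by apply/IH; rewrite -(@subVE c M fa va); exact: h.
by rewrite (@subVE c M fa va); apply/IH; exact: h.
Qed.

Lemma eq0_subspace : linear_subspace (eq^~ (0 : V)).
Proof. by split=> // a v w -> ->; rewrite scaler0 addr0. Qed.

(* The cosets [w + al i u + span us] of the codimension-one subspace split
   [w + span (u :: us)] into infinitely many pieces. *)
Lemma affine_morley_rank (us : seq V) (w : V) (al : nat -> F) :
  injective al -> free_mod (eq^~ 0) us ->
  morley_rank_ge (size us) (fun a : tup M (cone sV) => spanned us (subV (a tt) w)).
Proof.
move=> al_inj; elim: us w => [|u us IH] w /=.
  by move=> _; exists (@tone _ M sV w); rewrite /tone (@subVE c M fa va) subrr.
move=> [nu fus].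
exists (fun i a => spanned us (subV (a tt) (w + al i *: u))); split.
  move=> i j a; rewrite !(@subVE c M fa va) => /spannedE Ei /spannedE Ej.
  apply: contrapT => ij; apply: nu.
  have alij : al j - al i != 0.
    by rewrite subr_eq0; apply/eqP => /al_inj /esym.
  rewrite -[u]scale1r -(mulVf alij) -scalerA.
  have ss := span_mod_subspace eq0_subspace us.
  apply: (linear_subspaceZ _ ss).
  have := linear_subspaceB ss Ei Ej.
  by rewrite opprB addrC addrA subrK opprD addrA (addrC w) addrK scalerBl.
move=> i; split; first exact: spanned_definable; last exact: IH.
move=> a Ea; exists (al i); move: Ea.
by rewrite !(@subVE c M fa va) opprD addrA.
Qed.

(** A free family of size [n] would span a subspace of rank at least [n] inside the sort [V], so the
    other case of [free_or_spanning] holds. *)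
Lemma finite_rank_spanned (al : nat -> F) n : injective al ->
  ~ morley_rank_ge n (fun _ : tup M (cone sV) => True) ->
  exists us : seq V, forall v, span_mod (eq^~ 0) us v.
Proof.
move=> al_inj nr; have [//|/(_ n)[us szus fus]] := free_or_spanning (eq^~ (0 : V)).
case: nr; rewrite -szus; apply: morley_rank_ge_sub (affine_morley_rank 0 al_inj fus).
by [].
Qed.

End Rank.

(** * The sentence without models of finite Morley rank *)

Section Rich.
Local Open Scope ring_scope.
Variable c : nat.

(** [[v, ad_t^(c-2) u]] is a bracket of weight [c], in [v], [u] and [c - 2] copies of [t]. In a
    model of [T_0] its weight exceeds [c] as soon as [v] or [u] lies in [P_2], so it induces a
    bilinear map on [V/P_2]. *)
Definition pairing (M : structure (LKV c)) (t v u : M sV) : M sV :=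
  bracket v (iter (c - 2) (bracket t) u).

Definition theta2 (M : structure (LKV c)) (p q : M sV) : Prop :=
  theta (fun i : 'I_2 => if i == ord0 then p else q).

(** Finitely many first-order conditions, so that their conjunction is one sentence. Of the infinite
    scheme that interprets the [theta] predicates, [rich_independent] keeps a consequence about
    pairs. *)
Record rich (M : structure (LKV c)) : Prop := Rich {
  rich_field : field_axioms M;
  rich_space : vector_space_axioms M;
  rich_root : forall a : M sK, exists x, mulK x x = addK x a;
  rich_Dl : forall u v w : M sV,
    bracket (addV u v) w = addV (bracket u w) (bracket v w);
  rich_Dr : forall u v w : M sV,
    bracket w (addV u v) = addV (bracket w u) (bracket w v);
  rich_Zl : forall a (v w : M sV), bracket (scale a v) w = scale a (bracket v w);
  rich_Zr : forall a (v w : M sV), bracket v (scale a w) = scale a (bracket v w);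
  rich_laz2 : subspace (@laz c M 2);
  rich_pairing_l : forall t v u : M sV, laz 2 v -> pairing t v u = zeroV M;
  rich_pairing_r : forall t v u : M sV, laz 2 u -> pairing t v u = zeroV M;
  rich_nonderived : exists t : M sV, ~ laz 2 t;
  rich_plane : exists p q : M sV, [/\ laz c p, laz c q & theta2 p q];
  rich_independent : forall (p q : M sV) a, theta2 p q -> p <> scale a q /\ q <> scale a p;
  rich_pairing : forall t v1 v2 w : M sV, ~ laz 2 t -> ~ laz 2 v1 -> laz c w ->
    exists b u, pairing t v1 u = w /\ pairing t v2 u = scale b w }.

Section FiniteDimension.
Variables (M : structure (LKV c)) (rM : rich M).
Local Notation F := (scalars (rich_field rM)).
Local Notation V := (vectors (rich_field rM) (rich_space rM)).

Lemma pairing_linear_l (t u : V) a (v w : V) :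
  pairing t (a *: v + w : V) u = a *: (pairing t v u : V) + pairing t w u.
Proof.
rewrite /pairing; move: (iter _ _ _) => y.
exact: (etrans (rich_Dl rM _ _ _) (congr1 (fun z => addV z _) (rich_Zl rM _ _ _))).
Qed.

Lemma pairing_linear_r (t v : V) a (u w : V) :
  pairing t v (a *: u + w : V) = a *: (pairing t v u : V) + pairing t v w.
Proof.
have br_lin (x y z : V) : bracket x (a *: y + z : V) = a *: (bracket x y : V) + bracket x z.
  exact: (etrans (rich_Dr rM _ _ _) (congr1 (fun z => addV z _) (rich_Zr rM _ _ _))).
rewrite /pairing; have -> : iter (c - 2) (@bracket c M t) (a *: u + w : V) =
    a *: (iter (c - 2) (bracket t) u : V) + iter (c - 2) (bracket t) w.
  by elim: (c - 2)%N => //= n ->; exact: br_lin.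
exact: br_lin.
Qed.

Lemma rich_infinite_dimensional (us : seq V) : ~ forall v, span_mod (eq^~ 0) us v.
Proof.
move=> spus.
have [t nt] := rich_nonderived rM.
have [p [q [lp lq th]]] := rich_plane rM.
have pq a : p <> scale a q by have [] := rich_independent rM a th.
have qp a : q <> scale a p by have [] := rich_independent rM a th.
have line_subspace (x : V) : linear_subspace (fun v => exists a : F, v = a *: x).
  split; first by exists 0; rewrite scale0r.
  by move=> a v w [b ->] [d ->]; exists (a * b + d); rewrite scalerDl scalerA.
(* [l1] and [l2] are dual to [p] and [q]: [l1 p = l2 q = 1], while [l1] vanishes on the line of [q]
   and [l2] on the line of [p]. *)
have [l1 [l1_lin l1q l1p]] := @separating_functional _ V _ p (line_subspace q)
  (fun '(ex_intro a E) => pq a E).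
have [l2 [l2_lin l2p l2q]] := @separating_functional _ V _ q (line_subspace p)
  (fun '(ex_intro a E) => qp a E).
have lin0 (l : V -> F) : linear_for *%R l -> l 0 = 0.
  move=> lin; have := lin 1 0 0; rewrite scaler0 addr0 mul1r => /esym/eqP.
  by rewrite -subr_eq0 addrK => /eqP.
have s2 : linear_subspace (fun v : V => laz 2 v).
  have [s0 sD sZ] := rich_laz2 rM.
  by split=> // a v w lv lw; apply: sD => //; apply: sZ.
have [|||||||v2 v2P] := @nondegenerate_representation _ V (fun v => laz 2 v) s2
  (fun v u => l1 (pairing t v u)) (fun u => l2 (pairing t t u)) us.
- move=> v; have := spus v; elim: us v {spus} => [v ->|u us IH v [x /IH]] /=.
    by case: s2.
  by exists x.
- by move=> u a v w; rewrite pairing_linear_l l1_lin.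
- by move=> u a v w; rewrite pairing_linear_r l1_lin.
- by move=> a v w; rewrite pairing_linear_r l2_lin.
- by move=> v u lu; rewrite (rich_pairing_r rM) //; exact: lin0.
- by move=> u lu; rewrite (rich_pairing_r rM) //; exact: lin0.
(* Left nondegeneracy: for [v] outside [P_2] some [u] has [pairing t v u = p], where [l1] takes the
   value [1]. *)
- move=> v v0; apply: contrapT => nv.
  have [b [u [E _]]] := rich_pairing rM v nt nv lp.
  by have /eqP := v0 u; rewrite E l1p oner_eq0.
(* With [t] as [v1] and [q] as [w], the resulting [u] makes the two sides of [v2P] equal to [0] and
   [1]. *)
- have [b [u [E1 E2]]] := rich_pairing rM v2 nt nt lq.
  have /eqP := v2P u; rewrite E1 E2 l2q l1q ?(eq_sym 0) ?oner_eq0 //.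
  by exists b.
Qed.

End FiniteDimension.

(** The root condition makes the field infinite, so a finite bound on the rank would make [V]
    finite-dimensional. *)
Lemma rich_rank (M : structure (LKV c)) n : rich M ->
  morley_rank_ge n (fun _ : tup M (cone sV) => True).
Proof.
move=> rM; apply: contrapT => nr.
have [al al_inj] := @artin_schreier_infinite (scalars (rich_field rM)) (rich_root rM).
have [us spus] := finite_rank_spanned (rich_space rM) al_inj nr.
exact: rich_infinite_dimensional spus.
Qed.

End Rich.

(** * The conditions of [rich] as one first-order sentence *)

Ltac is_term_tac := cbv beta; first
  [ apply: is_term_addV | apply: is_term_subV | apply: is_term_bracket
  | apply: is_term_addK | apply: is_term_mulK | apply: is_term_scale
  | apply: is_term_oppK | apply: is_term_zeroV | apply: is_term_zeroK
  | apply: is_term_oneK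
  | match goal with |- @is_term ?L ?G _ (fun M v => v ?x) => exact: (@is_term_var L G x) end ].

Ltac express := cbv beta; first
  [ apply: expressible_all | apply: expressible_ex | apply: expressible_and
  | apply: expressible_not | apply: expressible_imp
  | apply: expressible_laz | apply: expressible_eq | is_term_tac ].

Section RichSentence.
Variable c : nat.
Local Notation expressible := (@expressible (LKV c) _).
Variable G : ctx lsort.

Lemma expressible_field : expressible (fun M (_ : tup M G) => field_axioms M).
Proof.
apply: (@expressible_iff (LKV c) _ (fun M _ =>
  (forall x y z : M sK, addK x (addK y z) = addK (addK x y) z) /\
  (forall x y : M sK, addK x y = addK y x) /\
  (forall x : M sK, addK (zeroK M) x = x) /\
  (forall x : M sK, addK (oppK x) x = zeroK M) /\
  (forall x y z : M sK, mulK x (mulK y z) = mulK (mulK x y) z) /\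
  (forall x y : M sK, mulK x y = mulK y x) /\
  (forall x : M sK, mulK (oneK M) x = x) /\
  (forall x y z : M sK, mulK (addK x y) z = addK (mulK x z) (mulK y z)) /\
  (oneK M <> zeroK M) /\
  (forall a : M sK, a <> zeroK M -> exists b, mulK b a = oneK M))).
  move=> M _; split=> [|[]]; last by do ![split=> //].
  by do 9![case=> ?]; split.
do ![express].
Qed.

Lemma expressible_space : expressible (fun M (_ : tup M G) => vector_space_axioms M).
Proof.
apply: (@expressible_iff (LKV c) _ (fun M _ =>
  (forall x y z : M sV, addV x (addV y z) = addV (addV x y) z) /\
  (forall x y : M sV, addV x y = addV y x) /\
  (forall x : M sV, addV (zeroV M) x = x) /\
  (forall v w : M sV, addV (subV v w) w = v) /\
  (forall a b (v : M sV), scale a (scale b v) = scale (mulK a b) v) /\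
  (forall v : M sV, scale (oneK M) v = v) /\
  (forall a (v w : M sV), scale a (addV v w) = addV (scale a v) (scale a w)) /\
  (forall a b (v : M sV), scale (addK a b) v = addV (scale a v) (scale b v)))).
  move=> M _; split=> [|[]]; last by do ![split=> //].
  by do 7![case=> ?]; split.
do ![express].
Qed.

Lemma is_term_pairing (t v u : forall M : structure (LKV c), tup M G -> M sV) :
  is_term t -> is_term v -> is_term u ->
  is_term (fun (M : structure (LKV c)) (x : tup M G) => @pairing c M (t M x) (v M x) (u M x)).
Proof.
move=> ft fv fu; apply: is_term_bracket => //.
by apply: is_term_iter => // y fy; apply: is_term_bracket.
Qed.

Lemma expressible_theta2 (p q : forall M : structure (LKV c), tup M G -> M sV) :
  is_term p -> is_term q -> expressible (fun M v => theta2 (p M v) (q M v)).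
Proof.
move=> fp fq; pose t (i : 'I_2) := if i == ord0 then p else q.
have ft i : is_term (t i) by rewrite /t; case: eqP.
apply: expressible_iff (expressible_theta ft) => M v.
rewrite /theta2 /t.
by have -> : (fun i : 'I_2 => (if i == ord0 then p else q) M v) =
  (fun i => if i == ord0 then p M v else q M v) by apply: funext => i; case: eqP.
Qed.
End RichSentence.

Ltac express_rich := cbv beta; first
  [ apply: expressible_field | apply: expressible_space | apply: expressible_theta2
  | apply: is_term_pairing | express ].

(** Once the records are unfolded into a conjunction, [express_rich] builds the sentence by
    following the connectives. *)
Lemma expressible_rich c :
  @expressible (LKV c) (cnil lsort) (fun M _ => rich M).
Proof.
apply: (@expressible_iff (LKV c) _ (fun M _ =>
 field_axioms M /\ vector_space_axioms M /\
  (forall a : M sK, exists x, mulK x x = addK x a) /\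
  (forall u v w : M sV,
    bracket (addV u v) w = addV (bracket u w) (bracket v w)) /\
  (forall u v w : M sV,
    bracket w (addV u v) = addV (bracket w u) (bracket w v)) /\
  (forall a (v w : M sV), bracket (scale a v) w = scale a (bracket v w)) /\
  (forall a (v w : M sV), bracket v (scale a w) = scale a (bracket v w)) /\
  (laz 2 (zeroV M) /\
   (forall v w : M sV, laz 2 v -> laz 2 w -> laz 2 (addV v w)) /\
   (forall a (v : M sV), laz 2 v -> laz 2 (scale a v))) /\
  (forall t v u : M sV, laz 2 v -> pairing t v u = zeroV M) /\
  (forall t v u : M sV, laz 2 u -> pairing t v u = zeroV M) /\
  (exists t : M sV, ~ laz 2 t) /\
  (exists p q : M sV, laz c p /\ laz c q /\ theta2 p q) /\
  (forall (p q : M sV) a, theta2 p q -> p <> scale a q /\ q <> scale a p) /\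
  (forall t v1 v2 w : M sV, ~ laz 2 t -> ~ laz 2 v1 -> laz c w ->
    exists b u, pairing t v1 u = w /\ pairing t v2 u = scale b w))).
  move=> M _; split=> [|[]].
    do 13![case=> ?]; split=> //.
    - by match goal with h : laz 2 (zeroV M) /\ _ |- _ => case: h => ? [] end.
    - by match goal with h : exists p q, _ |- _ => case: h => p [q [? [? ?]]]; exists p, q end.
  move=> ? ? ? ? ? ? ? [? ? ?] ? ? ? [p [q [? ? ?]]] ? ?.
  by do !split=> //; exists p, q.
do ![express_rich].
Qed.

(** * Embeddings *)

Lemma embedding_comp L (M N P : structure L) (e : forall s, M s -> N s)
    (e' : forall s, N s -> P s) :
  embedding e -> embedding e' -> embedding (fun s x => e' s (e s x)).
Proof.
move=> [ie fe re] [ie' fe' re']; split.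
- by move=> s x y /ie' /ie.
- by move=> f a; rewrite fe fe'.
- by move=> r a; rewrite re re'.
Qed.

Lemma embedding_id L (M : structure L) : embedding (fun s (x : M s) => x).
Proof. by split=> [s x y|//|r a]. Qed.

Section LieEmbedding.
Variables (c : nat) (M N : structure (LKV c)) (e : forall s, M s -> N s).

Lemma tmap_tnil : tmap e (@tnil _ M) = @tnil _ N.
Proof. by apply: functional_extensionality_dep => -[]. Qed.

Lemma tmap_tpair (s t : lsort) (x : M s) (y : M t) :
  tmap e (tpair x y) = tpair (e x) (e y).
Proof. by apply: functional_extensionality_dep => -[]. Qed.

Section Commute.
Hypothesis emb : embedding e.
Let e_f := let: And3 _ h _ := emb in h.
Let e_r := let: And3 _ _ h := emb in h.

Lemma emb_zeroV : e (zeroV M) = zeroV N.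
Proof. by rewrite /zeroV (e_f (f := fzeroV)) tmap_tnil. Qed.
Lemma emb_zeroK : e (zeroK M) = zeroK N.
Proof. by rewrite /zeroK (e_f (f := fzeroK)) tmap_tnil. Qed.
Lemma emb_oneK : e (oneK M) = oneK N.
Proof. by rewrite /oneK (e_f (f := foneK)) tmap_tnil. Qed.
Lemma emb_addV v w : e (addV v w) = addV (e v) (e w).
Proof. by rewrite /addV (e_f (f := faddV)) tmap_tpair. Qed.
Lemma emb_subV v w : e (subV v w) = subV (e v) (e w).
Proof. by rewrite /subV (e_f (f := fsubV)) tmap_tpair. Qed.
Lemma emb_addK a b : e (addK a b) = addK (e a) (e b).
Proof. by rewrite /addK (e_f (f := faddK)) tmap_tpair. Qed.
Lemma emb_mulK a b : e (mulK a b) = mulK (e a) (e b).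
Proof. by rewrite /mulK (e_f (f := fmulK)) tmap_tpair. Qed.
Lemma emb_oppK a : e (oppK a) = oppK (e a).
Proof. by rewrite /oppK (e_f (f := foppK)). Qed.
Lemma emb_scale a v : e (scale a v) = scale (e a) (e v).
Proof. by rewrite /scale (e_f (f := fscale)) tmap_tpair. Qed.
Lemma emb_bracket v w : e (bracket v w) = bracket (e v) (e w).
Proof. by rewrite /bracket (e_f (f := fbracket)) tmap_tpair. Qed.
Lemma emb_laz m v : laz m (e v) <-> laz m v.
Proof. by rewrite /laz e_r. Qed.
Lemma emb_theta2 p q : theta2 (e p) (e q) <-> theta2 p q.
Proof.
rewrite /theta2 /theta (e_r (r := rtheta c 2)).
suff -> : @tmap _ M N e (cpow sV 2) (fun i : 'I_2 => if i == ord0 then p else q) =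
  (fun i : 'I_2 => if i == ord0 then e p else e q) by [].
by apply: functional_extensionality_dep => i; rewrite /tmap /=; case: eqP.
Qed.
Lemma emb_iter_bracket n t v :
  e (iter n (bracket t) v) = iter n (bracket (e t)) (e v).
Proof. by elim: n => //= n <-; rewrite emb_bracket. Qed.
Lemma emb_pairing t v u : e (pairing t v u) = pairing (e t) (e v) (e u).
Proof. by rewrite /pairing emb_bracket emb_iter_bracket. Qed.

End Commute.
End LieEmbedding.

(** * A criterion for embeddings *)

Section EmbeddingIntro.
Variables (c : nat) (M N : structure (LKV c)).
Hypotheses (cM : coordinate_axioms M) (cN : coordinate_axioms N).
Variable e : forall s, M s -> N s.
Hypotheses (eV_inj : injective (@e sV)) (eK_inj : injective (@e sK)).
Hypotheses (e_zeroV : e (zeroV M) = zeroV N) (e_zeroK : e (zeroK M) = zeroK N)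
  (e_oneK : e (oneK M) = oneK N)
  (e_addV : forall v w, e (addV v w) = addV (e v) (e w))
  (e_subV : forall v w, e (subV v w) = subV (e v) (e w))
  (e_addK : forall v w, e (addK v w) = addK (e v) (e w))
  (e_mulK : forall v w, e (mulK v w) = mulK (e v) (e w))
  (e_oppK : forall v, e (oppK v) = oppK (e v))
  (e_scale : forall a v, e (scale a v) = scale (e a) (e v))
  (e_bracket : forall v w, e (bracket v w) = bracket (e v) (e w)).
Hypotheses
  (e_indep : forall n (v : 'I_n -> M sV), lin_indep v -> lin_indep (fun i => e (v i)))
  (e_span : forall n (v : 'I_n -> M sV) w a, e w = lincomb a (fun i => e (v i)) ->
    exists b, w = lincomb b v)
  (e_laz : forall i : 'I_c.+1, forall v,
    @rint _ M (rlaz i) (@tone _ M sV v) <-> @rint _ N (rlaz i) (@tone _ N sV (e v))).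

Let e_lincomb n (a : 'I_n -> M sK) v :
  e (lincomb a v) = lincomb (fun i => e (a i)) (fun i => e (v i)).
Proof. by rewrite /lincomb; elim/big_rec2: _ => // i x y _ <-; rewrite e_addV e_scale. Qed.

Let e_indepP n (v : 'I_n -> M sV) : lin_indep v <-> lin_indep (fun i => e (v i)).
Proof.
split=> [|iv a av i]; first exact: e_indep.
apply: eK_inj; rewrite e_zeroK; apply: (iv (fun i => e (a i))).
by rewrite -e_lincomb av e_zeroV.
Qed.

(** The coordinate axioms determine [theta] and the [pi] from the vector space structure. They are
    therefore respected once [e] preserves linear independence ([e_indep]) and no vector of [M]
    enters a span only after the scalars are enlarged ([e_span]). *)
Lemma embedding_intro : embedding e.
Proof.
split.
- by case.
- have pairE (X : structure (LKV c)) (s t : lsort) (a : tup X (cpair s t)) :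
      a = tpair (a true) (a false) by apply: functional_extensionality_dep => -[].
  have nilE (X : structure (LKV c)) (a : tup X (cnil lsort)) : a = @tnil _ X
    by apply: functional_extensionality_dep => -[].
  case=> /=.
  + by move=> a; rewrite (nilE _ a) tmap_tnil; exact: e_zeroV.
  + by move=> a; rewrite (pairE _ _ _ a) tmap_tpair; exact: e_addV.
  + by move=> a; rewrite (pairE _ _ _ a) tmap_tpair; exact: e_subV.
  + by move=> a; rewrite (nilE _ a) tmap_tnil; exact: e_zeroK.
  + by move=> a; rewrite (nilE _ a) tmap_tnil; exact: e_oneK.
  + by move=> a; rewrite (pairE _ _ _ a) tmap_tpair; exact: e_addK.
  + move=> a; have -> : a = @tone _ M sK (a tt) by apply: functional_extensionality_dep => -[].
    exact: e_oppK.
  + by move=> a; rewrite (pairE _ _ _ a) tmap_tpair; exact: e_mulK.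
  + by move=> a; rewrite (pairE _ _ _ a) tmap_tpair; exact: e_scale.
  + move=> n i a.
    have textE (X : structure (LKV c)) (b : tup X (cext (cpow sV n) sV)) :
        b = @text _ X (cpow sV n) sV (fun j => b (Some j)) (b None).
      by apply: functional_extensionality_dep => -[].
    rewrite [tmap e a]textE [in LHS](textE _ a).
    suff key (v : 'I_n -> M sV) w : e (pi i v w) = pi i (fun j => e (v j)) (e w).
      exact: (key (fun j => a (Some j)) (a None)).
    have [[iv [b wE]]|h] := pselect (lin_indep v /\ exists b, w = lincomb b v).
      by rewrite wE (pi_indep cM) // e_lincomb (pi_indep cN) //; apply: e_indep.
    (* Here [pi] takes its default value in [M]; [e_span] and the reflection of independence force
       the default in [N] as well. *)
    rewrite (pi_default cM) // e_zeroK (pi_default cN) // => -[/e_indepP iv [b /e_span hb]].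
    exact: h.
  + by move=> a; rewrite (pairE _ _ _ a) tmap_tpair; exact: e_bracket.
- case=> [n|i] a.
    apply: (iff_trans (thetaP cM a)); apply: (iff_trans _ (iff_sym (thetaP cN _))).
    exact: e_indepP.
  have -> : a = @tone _ M sV (a tt) by apply: functional_extensionality_dep => -[].
  exact: e_laz.
Qed.

End EmbeddingIntro.

(* The Lazard predicates are [dP 1, ..., dP c.+1]; [theta] and the [pi] carry no
   data since the theory determines them. *)
Record lie_data := LieData {
  dK : Type; dV : Type;
  d0K : dK; d1K : dK; daddK : dK -> dK -> dK; doppK : dK -> dK; dmulK : dK -> dK -> dK;
  d0V : dV; daddV : dV -> dV -> dV; dsubV : dV -> dV -> dV; dscale : dK -> dV -> dV;
  dbracket : dV -> dV -> dV; dP : nat -> dV -> Prop }.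

(** * Structures built from the data of a Lie algebra *)

Section LieStructure.
Variables (c : nat) (d : lie_data).

Definition lie_carrier (s : lsort) : Type := match s with sV => dV d | sK => dK d end.

Let lc n (a : 'I_n -> dK d) (v : 'I_n -> dV d) : dV d :=
  \big[@daddV d/d0V d]_(i < n) dscale (a i) (v i).

Let indep n (v : 'I_n -> dV d) : Prop :=
  forall a : 'I_n -> dK d, lc a v = d0V d -> forall i, a i = d0K d.

Let coordinate n (i : 'I_n) (v : 'I_n -> dV d) (w : dV d) : dK d :=
  if pselect (indep v /\ exists a, w = lc a v) is left h
  then projT1 (cid h.2) i else d0K d.

Definition lie_fint (f : lfunc) :
    tup lie_carrier (lfdom f) -> lie_carrier (lfcod f) :=
  match f return tup lie_carrier (lfdom f) -> lie_carrier (lfcod f) with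
  | fzeroV => fun=> d0V d
  | faddV => fun a => daddV (a true) (a false)
  | fsubV => fun a => dsubV (a true) (a false)
  | fzeroK => fun=> d0K d
  | foneK => fun=> d1K d
  | faddK => fun a => daddK (a true) (a false)
  | foppK => fun a => doppK (a tt)
  | fmulK => fun a => dmulK (a true) (a false)
  | fscale => fun a => dscale (a true) (a false)
  | fpi n i => fun a => coordinate i (fun j => a (Some j)) (a None)
  | fbracket => fun a => dbracket (a true) (a false)
  end.

Definition lie_rint (r : lrel c) : tup lie_carrier (lrdom r) -> Prop :=
  match r return tup lie_carrier (lrdom r) -> Prop with
  | rtheta n => fun a => indep a
  | rlaz i => fun a => dP i.+1 (a tt)
  end.

Definition lie_structure : structure (LKV c) :=
  @Structure (LKV c) lie_carrier lie_fint lie_rint.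

Lemma lie_structure_laz m (v : dV d) : 1 <= m ->
  @laz c lie_structure m v <-> dP (minn m c.+1) v.
Proof.
move=> m1; rewrite /laz /=.
have -> : (@inord c (minn m c.+1).-1).+1 = minn m c.+1 by rewrite inordK; lia.
by [].
Qed.

(** The coefficients chosen in [coordinate] are the given ones: independence applies to the
    differences. *)
Lemma lie_structure_coordinates :
  field_axioms lie_structure -> vector_space_axioms lie_structure ->
  coordinate_axioms lie_structure.
Proof.
move=> fa va; split=> //.
- move=> n v a iv i.
  change (coordinate i v (lc a v) = a i).
  rewrite /coordinate; case: pselect => [h|[]]; last by split=> //; exists a.
  case: cid => /= b E.
  pose F := scalars fa; pose V := vectors fa va.
  have {}E : (\sum_j (a j : F) *: (v j : V) = \sum_j (b j : F) *: (v j : V))%R by exact: E.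
  suff /eqP : ((b i : F) - (a i : F) = 0)%R by rewrite subr_eq0 => /eqP.
  apply: (iv (fun j => (b j : F) - (a j : F))%R).
  have : (\sum_j ((b j : F) - (a j : F)) *: (v j : V) = 0)%R.
    by under eq_bigr => j _ do rewrite scalerBl; rewrite sumrB E subrr.
  exact.
- move=> n v w h i.
  change (coordinate i v w = d0K d).
  by rewrite /coordinate; case: pselect.
Qed.

End LieStructure.

(** * Adjoining a vector *)

(** These are the linear functionals on [V/P_2]; in a model of [T_0] they vanish on all brackets. *)
Definition grade1_functional c (N : structure (LKV c)) (k : N sV -> N sK) :=
  [/\ forall v w, k (addV v w) = addK (k v) (k w),
      forall a v, k (scale a v) = mulK a (k v)
    & forall v, laz 2 v -> k v = zeroK N].

Section VectorExtension.
Variables (c : nat) (N : structure (LKV c)) (hN : models_T0 N).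
Let fa := T0_field hN.
Let va := T0_vector_space hN.
Let lie := T0_lie hN.
Let lz := T0_lazard hN.
Local Notation F := (scalars fa).
Local Notation V := (vectors fa va).

Lemma laz_minn m (v : N sV) : laz (minn m c.+1) v <-> laz m v.
Proof. by rewrite /laz -minnA minnn. Qed.

Lemma laz_mono i m (v : N sV) : 1 <= i <= m -> laz m v -> laz i v.
Proof.
have mono n : i + n <= c.+1 -> 1 <= i -> laz (i + n) v -> laz i v.
  elim: n => [|n IH]; first by rewrite addn0.
  rewrite addnS => hn i1 h; apply: IH => //; first lia.
  by apply: (laz_decr lz) h; lia.
move=> im /(proj2 (laz_minn m v)) lv; apply: (proj1 (laz_minn i v)).
have [le_ic|lt_ci] : i <= c.+1 \/ c.+1 < i by lia.
  2: by have -> : minn i c.+1 = minn m c.+1 by lia.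
have -> : minn i c.+1 = i by lia.
have E : minn m c.+1 = i + (minn m c.+1 - i) by lia.
by rewrite E in lv; apply: mono lv; lia.
Qed.

Variables (j : nat) (k : N sV -> N sK) (x y : N sV).
Hypotheses (hj : 1 <= j <= c) (hk : grade1_functional k) (lx : laz j.+1 x)
  (bx : forall v, bracket v x = scale (k v) y).

Let kF : V -> F := k.
Let br : V -> V -> V := @bracket c N.
Let kD v w : kF (v + w)%R = (kF v + kF w)%R. Proof. by case: hk => h _ _; exact: h. Qed.
Let kZ a v : kF (a *: v)%R = (a * kF v)%R. Proof. by case: hk => _ h _; exact: h. Qed.
Let k2 v : laz 2 v -> kF v = 0%R. Proof. by case: hk => _ _ h; exact: h. Qed.
Let kx : kF x = 0%R. Proof. by apply: k2; apply: laz_mono lx; lia. Qed.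
Let kbr v w : kF (br v w) = 0%R.
Proof.
apply: k2; apply: (laz_bracket lz (i := 1) (j := 1)); try lia; exact: (laz_first lz).
Qed.
Let brDl u v w : br (u + v)%R w = (br u w + br v w)%R. Proof. exact: (bracketDl lie). Qed.
Let brDr u v w : br w (u + v)%R = (br w u + br w v)%R. Proof. exact: (bracketDr lie). Qed.
Let brZl a v w : br (a *: v)%R w = (a *: br v w)%R. Proof. exact: (bracketZl lie). Qed.
Let brZr a v w : br v (a *: w)%R = (a *: br v w)%R. Proof. exact: (bracketZr lie). Qed.
Let brx v : br v x = (kF v *: (y : V))%R. Proof. exact: bx. Qed.
Let br0 v : br v 0%R = 0%R. Proof. by have := brZr 0%R v 0%R; rewrite !scale0r. Qed.

Local Notation V1 := (V * F^o)%type.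
Local Open Scope ring_scope.

(* [V + K u] with [[v, u] = k(v) x]; [u] is put in the first [j] Lazard subspaces. *)
Definition vector_extension_bracket (v w : V1) : V1 :=
  (br v.1 w.1 + (w.2 * kF v.1 - v.2 * kF w.1) *: (x : V), 0).

Definition vector_extension_laz m (v : V1) : Prop :=
  laz m v.1 /\ ((m <= j)%N \/ v.2 = 0).

Definition vector_extension_data : lie_data :=
  @LieData F V1 0 1 +%R (@GRing.opp F) *%R 0 +%R (fun v w => v - w) *:%R
    vector_extension_bracket vector_extension_laz.

Definition vector_extension : structure (LKV c) := lie_structure c vector_extension_data.
Local Notation N1 := vector_extension.

Let fa1 : field_axioms N1.
Proof.
split; [exact: (addKA fa)|exact: (addKC fa)|exact: (add0K fa)|exact: (addNK fa)
 |exact: (mulKA fa)|exact: (mulKC fa)|exact: (mul1K fa)|exact: (mulKDl fa)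
 |exact: (oneK_neq0 fa)|exact: (mulVK fa)].
Qed.

Let va1 : vector_space_axioms N1.
Proof.
split; [exact: (@addrA V1)|exact: (@addrC V1)|exact: (@add0r V1)|exact: (fun v w => @subrK V1 w v)
 |exact: (@scalerA F V1)|exact: (@scale1r F V1)|exact: (@scalerDr F V1)|].
by move=> a b v; exact: (@scalerDl F V1).
Qed.

Let lie1 : lie_axioms N1.
Proof.
split.
- move=> v; change (vector_extension_bracket v v = 0).
  rewrite /vector_extension_bracket subrr scale0r addr0.
  by congr (_, _); exact: (bracket_alt lie).
- move=> u v w.
  change (vector_extension_bracket (u + v) w =
    vector_extension_bracket u w + vector_extension_bracket v w).
  rewrite /vector_extension_bracket /=; congr (_, _); last by rewrite addr0.
  rewrite brDl addrACA -scalerDl kD; congr (_ + _ *: _).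
  by rewrite /=; ring.
- move=> u v w.
  change (vector_extension_bracket w (u + v) =
    vector_extension_bracket w u + vector_extension_bracket w v).
  rewrite /vector_extension_bracket /=; congr (_, _); last by rewrite addr0.
  rewrite brDr addrACA -scalerDl kD; congr (_ + _ *: _).
  by rewrite /=; ring.
- move=> a v w.
  change (vector_extension_bracket (a *: v) w = a *: vector_extension_bracket v w).
  rewrite /vector_extension_bracket /=; congr (_, _); last by rewrite scaler0.
  rewrite brZl scalerDr scalerA kZ; congr (_ + _ *: _).
  by rewrite (_ : a *: v.2 = a * (v.2 : F)) //; ring.
- move=> a v w.
  change (vector_extension_bracket v (a *: w) = a *: vector_extension_bracket v w).
  rewrite /vector_extension_bracket /=; congr (_, _); last by rewrite scaler0.
  rewrite brZr scalerDr scalerA kZ; congr (_ + _ *: _).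
  by rewrite (_ : a *: w.2 = a * (w.2 : F)) //; ring.
- move=> u v w.
  (* Since [k] kills brackets and [x], and [[v, x] = k(v) y], the new part of a double bracket is a
     multiple of [y]. The three coefficients in the Jacobi sum cancel because [k(p) k(q)] is
     symmetric. *)
  have brbr p q r : vector_extension_bracket p (vector_extension_bracket q r) =
      (br p.1 (br q.1 r.1) + ((r.2 * kF q.1 - q.2 * kF r.1) * kF p.1) *: (y : V), 0).
    rewrite /vector_extension_bracket /=; congr (_, _).
    by rewrite kD kbr kZ kx mulr0 addr0 mul0r mulr0 subrr scale0r addr0 brDr brZr brx scalerA.
  change (vector_extension_bracket u (vector_extension_bracket v w) +
    (vector_extension_bracket v (vector_extension_bracket w u) +
     vector_extension_bracket w (vector_extension_bracket u v)) = 0).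
  rewrite !brbr; congr (_, _); last by rewrite /= !addr0.
  rewrite /= [X in _ + X = _]addrACA [LHS]addrACA.
  have -> : br u.1 (br v.1 w.1) + (br v.1 (br w.1 u.1) + br w.1 (br u.1 v.1)) = 0.
    exact: (jacobi lie).
  rewrite add0r -!scalerDl; apply: (etrans _ (scale0r (y : V))); congr (_ *: _).
  by ring.
Qed.

Let laz1E m (v : V1) : (1 <= m)%N ->
  @laz c N1 m v <-> laz m v.1 /\ ((minn m c.+1 <= j)%N \/ v.2 = 0).
Proof.
move=> m1; apply: (iff_trans (@lie_structure_laz c vector_extension_data m v m1)).
by rewrite /= /vector_extension_laz laz_minn.
Qed.

Let laz_linear i : (1 <= i <= c.+1)%N ->
  [/\ @laz c N i (0 : V), forall v w : V, @laz c N i v -> @laz c N i w -> @laz c N i (v + w)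
    & forall a (v : V), @laz c N i v -> @laz c N i (a *: v)].
Proof. by move=> hi; exact: (laz_subspace lz hi). Qed.

(** A nonzero [a] forces [l <= j]. For [i = 1] the vector [x], being in [P_(j+1)], is then deep
    enough; for [i >= 2] the functional [k] kills [v]. *)
Let laz_bracket1 i l a (v : V) : (1 <= i <= c.+1)%N -> (1 <= l <= c.+1)%N ->
  laz i v -> ((minn l c.+1 <= j)%N \/ a = 0) ->
  @laz c N (minn (i + l) c.+1) ((a * kF v) *: (x : V)).
Proof.
move=> hi hl lv; have [|l0 _ lZ] := @laz_linear (minn (i + l) c.+1); first lia.
case=> [lj|->]; last by rewrite mul0r scale0r.
have [i1|i1] : (i = 1 \/ 2 <= i)%N by lia.
  by apply: lZ; apply: laz_mono lx; lia.
by rewrite k2 ?mulr0 ?scale0r //; apply: laz_mono lv; lia.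
Qed.

Let lz1 : lazard_axioms N1.
Proof.
split.
- move=> i hi; have [l0 lD lZ] := laz_linear hi.
  have i1 : (1 <= i)%N by lia.
  split.
  + by apply/laz1E => //; split=> //; right.
  + move=> v w /(laz1E _ i1)[lv jv] /(laz1E _ i1)[lw jw]; apply/laz1E => //; split; first exact: lD.
    case: jv => [|jv]; first by left.
    case: jw => [|jw]; first by left.
    by right; change (v.2 + w.2 = 0 :> F); rewrite jv jw addr0.
  + move=> a v /(laz1E _ i1)[lv jv]; apply/laz1E => //; split; first exact: lZ.
    case: jv => [|jv]; first by left.
    by right; change (a * (v.2 : F) = 0); rewrite jv mulr0.
- by move=> v; apply/laz1E => //; split; [exact: (laz_first lz)|left; lia].
- move=> i hi v /laz1E[//|lv jv]; apply/laz1E; first lia.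
  split; first by apply: (laz_decr lz).
  by case: jv => [jv|]; [left; lia|right].
- move=> v; split=> [/laz1E[//|/(laz_last lz) v1 [jv|v2]]|->].
  + by lia.
  + by case: v v1 v2 => /= v1 v2 -> ->.
  + by apply/laz1E => //; split; [exact/(laz_last lz)|right].
- move=> i l hi hl v w /laz1E[|lv jv]; first lia.
  move=> /laz1E[|lw jw]; first lia.
  apply/laz1E; first lia.
  split; last by right.
  have [|l0 lD lZ] := @laz_linear (minn (i + l) c.+1); first lia.
  apply: (proj1 (laz_minn _ _)).
  apply: (lD _ _); first by apply: (proj2 (laz_minn _ _)); apply: (laz_bracket lz).
  rewrite scalerBl; apply: (lD _ _); first exact: laz_bracket1.
  rewrite -scaleN1r; apply: lZ; rewrite addnC; exact: laz_bracket1.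
Qed.

Lemma vector_extension_T0 : models_T0 N1.
Proof. by split=> //; apply: lie_structure_coordinates. Qed.

Definition vector_extension_inj s : N s -> N1 s :=
  match s return N s -> N1 s with
  | sV => fun v => (v, 0) | sK => fun a => a end.

Let lincomb_fst n (a : 'I_n -> N sK) (v : 'I_n -> V1) :
  (@lincomb c N1 n a v : V1).1 = lincomb a (fun i => (v i).1).
Proof. by rewrite /lincomb; elim/big_rec2: _ => // i z t _ <-. Qed.

Lemma vector_extension_embedding : embedding vector_extension_inj.
Proof.
apply: embedding_intro => //.
- exact: (T0_coordinates hN).
- exact: (T0_coordinates vector_extension_T0).
- by move=> v w [].
- by move=> v w; congr (_, _); rewrite addr0.
- by move=> v w; congr (_, _); [exact: (@subVE c N fa va)|rewrite subr0].
- by move=> a v; congr (_, _); rewrite scaler0.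
- move=> v w; congr (_, _).
  by rewrite /= !mul0r subrr scale0r addr0.
- move=> n v iv a E; apply: iv.
  by have := lincomb_fst a (fun i => (v i, 0)); rewrite E => /esym.
- move=> n v w a E; exists a.
  by have := lincomb_fst a (fun i => (v i, 0)); rewrite -E.
- move=> i v.
  have rlazE (X : structure (LKV c)) (z : X sV) :
      @rint _ X (rlaz i) (@tone _ X sV z) <-> laz i.+1 z.
    rewrite /laz; have -> : inord (minn i.+1 c.+1).-1 = i; last by [].
    by apply: val_inj; rewrite /= inordK; have := ltn_ord i; lia.
  apply: (iff_trans (rlazE N v)); apply: (iff_trans _ (iff_sym (rlazE N1 _))).
  split=> [lv|/laz1E[]//].
  by apply/laz1E => //; split=> //; right.
Qed.

(** The construction can be repeated: [k1] extends [k], and the formula for [[v, u]] is the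
    hypothesis [bx] of the next step, with [u] in the role of [x]. The last clause, that the field
    does not grow and [u] is independent from the old vectors, serves [extension_plane]. *)
Lemma extension_vector :
  exists (N1 : structure (LKV c)) (e : forall s, N s -> N1 s)
    (k1 : N1 sV -> N1 sK) (u : N1 sV),
    [/\ models_T0 N1, embedding e,
      grade1_functional k1 /\ (forall v, k1 (e sV v) = e sK (k v)),
      [/\ laz j u, ~ laz j.+1 u & forall v, bracket v u = scale (k1 v) (e sV x)]
    & (forall b, exists a, e sK a = b) /\ (forall b v, scale b u = e sV v -> b = zeroK N1)].
Proof.
exists N1, vector_extension_inj, (fun v : V1 => k v.1), ((0, 1) : V1); split.
- exact: vector_extension_T0.
- exact: vector_extension_embedding.
- split=> //; split.
  + by move=> v w; exact: kD.
  + by move=> a v; exact: kZ.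
  + by move=> v /laz1E[//|lv _]; exact: k2.
- split.
  + apply/laz1E; first lia.
    by split; [have [|] := @laz_linear j; first lia|left; lia].
  + by move=> /laz1E[//|_ [|/eqP]]; [lia|rewrite oner_eq0].
  + move=> v; change (vector_extension_bracket v (0, 1) = kF v.1 *: ((x, 0) : V1)).
    rewrite /vector_extension_bracket; congr (_, _); last by rewrite scaler0.
    have -> : kF 0 = 0 by have := kZ 0 0; rewrite scale0r mul0r.
    by rewrite /= br0 add0r mul1r mulr0 subr0.
- split; first by move=> b; exists b.
  move=> b v /(congr1 (fun z : V1 => z.2)) E.
  by have : (b : F) * 1 = 0 by []; rewrite mulr1.
Qed.

End VectorExtension.

(** * Adjoining a root of [z^2 = z + al] *)

(* Reduces an identity between vectors to one between scalars, which [ring] can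
   decide. *)
Lemma functionals_separate (F : fieldType) (V : lmodType F) (v w : V) :
  (forall k : V -> F, (forall x y, k (x + y) = k x + k y)%R ->
     (forall a x, k (a *: x) = a * k x)%R -> (forall x, k (- x) = - k x)%R ->
     k 0%R = 0%R -> k v = k w) -> v = w.
Proof.
move=> h; apply: contrapT => vw.
have [||k [klin _ k1]] := @separating_functional F V (fun z => z = 0%R) (v - w)%R.
- by split=> // a y z -> ->; rewrite scaler0 addr0.
- by move/eqP; rewrite subr_eq0 => /eqP.
have kD x y : (k (x + y) = k x + k y)%R by rewrite -[x in LHS]scale1r klin mul1r.
have k0 : k 0%R = 0%R by apply: (@addrI _ (k 0%R)); rewrite -kD !addr0.
have kZ a x : (k (a *: x) = a * k x)%R by rewrite -[(a *: x)%R]addr0 klin k0 addr0.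
have kN x : (k (- x) = - k x)%R by rewrite -scaleN1r kZ mulN1r.
by move/eqP: k1; rewrite kD kN (h k) // subrr eq_sym oner_eq0.
Qed.

Section RootExtension.
Variables (c : nat) (N : structure (LKV c)) (hN : models_T0 N) (al : N sK).
Let fa := T0_field hN.
Let va := T0_vector_space hN.
Let lie := T0_lie hN.
Let lz := T0_lazard hN.
Local Notation F := (scalars fa).
Local Notation V := (vectors fa va).
Hypothesis irr : forall z : F, (z * z)%R <> (z + al)%R.
Local Open Scope ring_scope.

Let a0 : F := al.
Let br : V -> V -> V := @bracket c N.
Let brDl u v w : br (u + v) w = br u w + br v w. Proof. exact: (bracketDl lie). Qed.
Let brDr u v w : br w (u + v) = br w u + br w v. Proof. exact: (bracketDr lie). Qed.
Let brZl a v w : br (a *: v) w = a *: br v w. Proof. exact: (bracketZl lie). Qed.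
Let brZr a v w : br v (a *: w) = a *: br v w. Proof. exact: (bracketZr lie). Qed.
Let brC v w : br v w = - br w v.
Proof.
have alt z : br z z = 0 by exact: (bracket_alt lie).
have := alt (v + w); rewrite brDl !brDr !alt add0r addr0 => /eqP.
by rewrite addr_eq0 => /eqP.
Qed.

Local Notation K1 := (F * F)%type.
Local Notation V1 := (V * V)%type.

(* [(a, b)] stands for [a + b z] with [z ^ 2 = z + al]. *)
Definition root_extension_mul (a b : K1) : K1 :=
  (a.1 * b.1 + a0 * (a.2 * b.2), a.1 * b.2 + a.2 * b.1 + a.2 * b.2).
Definition root_extension_scale (a : K1) (v : V1) : V1 :=
  (a.1 *: v.1 + (a0 * a.2) *: v.2, a.1 *: v.2 + a.2 *: v.1 + a.2 *: v.2).
Definition root_extension_bracket (v w : V1) : V1 :=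
  (br v.1 w.1 + a0 *: br v.2 w.2, br v.1 w.2 + br v.2 w.1 + br v.2 w.2).

(** Extension of scalars to the quadratic extension [K1]: the pair [(v, w)] stands for [v + z w],
    and each Lazard subspace is extended along with [V]. *)
Definition root_extension_data : lie_data :=
  @LieData K1 V1 0 (1, 0) +%R (@GRing.opp K1) root_extension_mul
    0 +%R (fun v w => v - w) root_extension_scale root_extension_bracket
    (fun m v => @laz c N m v.1 /\ @laz c N m v.2).

Definition root_extension : structure (LKV c) := lie_structure c root_extension_data.
Local Notation N1 := root_extension.

(** The expression is the norm of [a + b z]. If it vanished with [b] nonzero, [- a / b] would be a
    root in [F]. *)
Let norm_neq0 (a b : F) : (a, b) <> 0 :> K1 -> a * a + a * b - a0 * (b * b) <> 0.
Proof.
move=> ab0 n0; have [b0|b0] := eqVneq b 0.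
  apply: ab0; move: n0; rewrite b0 !mulr0 addr0 subr0 => /eqP.
  by rewrite mulf_eq0 orbb => /eqP ->.
apply: (irr (z := - a / b)).
have -> : (al : F) = (a * a + a * b) / (b * b).
  by apply: (mulIf (mulf_neq0 b0 b0)); rewrite mulfVK ?mulf_neq0 //; apply/eqP;
     rewrite eq_sym -subr_eq0 n0.
by field.
Qed.

Let fa1 : field_axioms N1.
Proof.
split.
- exact: (@addrA K1).
- exact: (@addrC K1).
- exact: (@add0r K1).
- exact: (@addNr K1).
- move=> a b d; change (root_extension_mul a (root_extension_mul b d) =
    root_extension_mul (root_extension_mul a b) d).
  by rewrite /root_extension_mul /=; congr (_, _); ring.
- move=> a b; change (root_extension_mul a b = root_extension_mul b a).
  by rewrite /root_extension_mul /=; congr (_, _); ring.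
- move=> [a b]; change (root_extension_mul (1, 0) (a, b) = (a, b)).
  by rewrite /root_extension_mul /=; congr (_, _); ring.
- move=> a b d; change (root_extension_mul (a + b) d =
    root_extension_mul a d + root_extension_mul b d).
  by rewrite /root_extension_mul /=; congr (_, _); rewrite /=; ring.
- by move=> /(congr1 fst) /eqP; rewrite oner_eq0.
- move=> [a b] /norm_neq0 /eqP n0; set n := (X in X != 0) in n0.
  (* The conjugate of [z] is [1 - z], so the inverse is the conjugate [(a + b) - b z] divided by the
     norm. *)
  exists ((a + b) / n, - b / n).
  change (root_extension_mul ((a + b) / n, - b / n) (a, b) = (1, 0)).
  by rewrite /root_extension_mul /=; congr (_, _); rewrite /n in n0 *; field.
Qed.

Ltac vector_ring :=
  let k := fresh in let kD := fresh in let kZ := fresh in let kN := fresh in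
  let k0 := fresh in
  apply: functionals_separate; intros k kD kZ kN k0;
  rewrite ?(brDl, brDr, brZl, brZr, kD, kZ, kN, k0); ring.

Let va1 : vector_space_axioms N1.
Proof.
split.
- exact: (@addrA V1).
- exact: (@addrC V1).
- exact: (@add0r V1).
- exact: (fun v w => @subrK V1 w v).
- move=> a b v; change (root_extension_scale a (root_extension_scale b v) =
    root_extension_scale (root_extension_mul a b) v).
  by rewrite /root_extension_scale /root_extension_mul /=; congr (_, _); vector_ring.
- move=> [v w]; change (root_extension_scale (1, 0) (v, w) = (v, w)).
  by rewrite /root_extension_scale /=; congr (_, _); vector_ring.
- move=> a v w; change (root_extension_scale a (v + w) =
    root_extension_scale a v + root_extension_scale a w).
  by rewrite /root_extension_scale /=; congr (_, _); rewrite /=; vector_ring.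
- move=> a b v; change (root_extension_scale (a + b) v =
    root_extension_scale a v + root_extension_scale b v).
  by rewrite /root_extension_scale /=; congr (_, _); rewrite /=; vector_ring.
Qed.

Let lie1 : lie_axioms N1.
Proof.
have alt z : br z z = 0 by exact: (bracket_alt lie).
split.
- move=> v; change (root_extension_bracket v v = 0).
  rewrite /root_extension_bracket !alt scaler0 addr0 (brC v.1 v.2) addNr addr0.
  by [].
- move=> u v w; change (root_extension_bracket (u + v) w =
    root_extension_bracket u w + root_extension_bracket v w).
  by rewrite /root_extension_bracket /=; congr (_, _); rewrite /=; vector_ring.
- move=> u v w; change (root_extension_bracket w (u + v) =
    root_extension_bracket w u + root_extension_bracket w v).
  by rewrite /root_extension_bracket /=; congr (_, _); rewrite /=; vector_ring.
- move=> a v w; change (root_extension_bracket (root_extension_scale a v) w =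
    root_extension_scale a (root_extension_bracket v w)).
  by rewrite /root_extension_bracket /root_extension_scale /=; congr (_, _);
     vector_ring.
- move=> a v w; change (root_extension_bracket v (root_extension_scale a w) =
    root_extension_scale a (root_extension_bracket v w)).
  by rewrite /root_extension_bracket /root_extension_scale /=; congr (_, _);
     vector_ring.
- move=> [u u'] [v v'] [w w']; change (
    root_extension_bracket (u, u') (root_extension_bracket (v, v') (w, w')) +
    (root_extension_bracket (v, v') (root_extension_bracket (w, w') (u, u')) +
     root_extension_bracket (w, w') (root_extension_bracket (u, u') (v, v'))) = 0).
  (* The Jacobi identity as a rewrite rule, instantiated for the eight choices of one component of
     each vector. It eliminates the double brackets whose outer vector is [u] or [u']. *)
  have J x y z : br x (br y z) = - br y (br z x) - br z (br x y).
    apply/eqP; rewrite -subr_eq0 -opprD opprK; apply/eqP.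
    exact: (jacobi lie).
  have JJ := (J u v w, J u v w', J u v' w, J u v' w', J u' v w, J u' v w', J u' v' w, J u' v' w').
  by rewrite /root_extension_bracket /=; congr (_, _); rewrite /= ?(brDr, brZr) !JJ;
    vector_ring.
Qed.

Let laz1E m (v : V1) : (1 <= m)%N -> @laz c N1 m v <-> @laz c N m v.1 /\ @laz c N m v.2.
Proof.
move=> m1; apply: (iff_trans (@lie_structure_laz c root_extension_data m v m1)).
by rewrite /= !laz_minn.
Qed.

Let laz_linear i : (1 <= i <= c.+1)%N ->
  [/\ @laz c N i (0 : V), forall v w : V, @laz c N i v -> @laz c N i w -> @laz c N i (v + w)
    & forall a (v : V), @laz c N i v -> @laz c N i (a *: v)].
Proof. by move=> hi; exact: (laz_subspace lz hi). Qed.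

Let lz1 : lazard_axioms N1.
Proof.
split.
- move=> i hi; have [l0 lD lZ] := laz_linear hi.
  have i1 : (1 <= i)%N by lia.
  split.
  + by apply/laz1E.
  + by move=> v w /(laz1E _ i1)[? ?] /(laz1E _ i1)[? ?]; apply/laz1E => //; split; apply: (lD _ _).
  + move=> a v /(laz1E _ i1)[? ?]; apply/laz1E => //; split; rewrite /=.
      by apply: (lD _ _); apply: lZ.
    by apply: (lD _ _); [apply: (lD _ _)|]; apply: lZ.
- by move=> v; apply/laz1E => //; split; exact: (laz_first lz).
- move=> i hi v /laz1E[//|? ?]; apply/laz1E; first lia.
  by split; apply: (laz_decr lz).
- move=> v; split=> [/laz1E[//|/(laz_last lz) v1 /(laz_last lz) v2]|->].
    by case: v v1 v2 => /= v1 v2 -> ->.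
  by apply/laz1E => //; split; exact/(laz_last lz).
- move=> i l hi hl v w /laz1E[|? ?]; first lia.
  move=> /laz1E[|? ?]; first lia.
  apply/laz1E; first lia.
  have [|_ lD lZ] := @laz_linear (minn (i + l) c.+1); first lia.
  have lb p q : laz i p -> laz l q -> @laz c N (minn (i + l) c.+1) (br p q).
    by move=> ? ?; apply: (proj2 (laz_minn _ _)); apply: (laz_bracket lz).
  split; apply: (proj1 (laz_minn _ _)); rewrite /=.
    by apply: (lD _ _); [|apply: lZ]; apply: lb.
  by apply: (lD _ _); [apply: (lD _ _)|]; apply: lb.
Qed.

Lemma root_extension_T0 : models_T0 N1.
Proof. by split=> //; apply: lie_structure_coordinates. Qed.

Definition root_extension_inj s : N s -> N1 s :=
  match s return N s -> N1 s with
  | sV => fun v : V => ((v, 0) : V1) | sK => fun a : F => ((a, 0) : K1) end.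

(** A linear combination of old vectors over [K1] is a pair of combinations over [F]. Hence
    independence is preserved, and an old vector in the new span is already in the old one. *)
Let lincomb_pair n (a : 'I_n -> K1) (v : 'I_n -> N sV) :
  @lincomb c N1 n a (fun i => root_extension_inj (v i)) =
  ((lincomb (fun i => (a i).1) v, lincomb (fun i => (a i).2) v) : V1).
Proof.
rewrite /lincomb; elim/big_rec3: _ => // i y2 y1 y _ ->.
change (root_extension_scale (a i) (v i, 0) + (y1, y2) =
  (((a i).1 *: (v i : V) + y1 : V), ((a i).2 *: (v i : V) + y2 : V)) :> V1).
by rewrite /root_extension_scale /= !scaler0 !addr0 add0r.
Qed.

Lemma root_extension_embedding : embedding root_extension_inj.
Proof.
apply: embedding_intro.
- exact: (T0_coordinates hN).
- exact: (T0_coordinates root_extension_T0).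
- by move=> v w [].
- by move=> v w [].
- by [].
- by [].
- by [].
- by move=> v w; congr (_, _); rewrite addr0.
- by move=> v w; congr (_, _); [exact: (@subVE c N fa va)|rewrite subr0].
- by move=> v w; congr (_, _); rewrite addr0.
- by move=> a b; congr (_, _); rewrite /= ?mulr0 ?mul0r ?addr0.
- by move=> a; congr (_, _); rewrite oppr0.
- by move=> a v; congr (_, _); rewrite /= ?mulr0 ?scale0r ?scaler0 ?addr0.
- move=> v w; change ((br v w, 0) = root_extension_bracket (v, 0) (w, 0) :> V1).
  have br0 z : br z 0 = 0 by have := brZr 0 z 0; rewrite !scale0r.
  have br0l z : br 0 z = 0 by have := brZl 0 0 z; rewrite !scale0r.
  by rewrite /root_extension_bracket /= !br0 br0l scaler0 !addr0.
- move=> n v iv a; rewrite lincomb_pair => -[E1 E2] i.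
  by have := iv _ E1 i; have := iv _ E2 i; case: (a i) => /= ? ? -> ->.
- move=> n v w a; rewrite lincomb_pair => -[E1 _].
  by exists (fun i => (a i).1).
- move=> i v.
  have rlazE (X : structure (LKV c)) (z : X sV) :
      @rint _ X (rlaz i) (@tone _ X sV z) <-> laz i.+1 z.
    rewrite /laz; have -> : inord (minn i.+1 c.+1).-1 = i; last by [].
    by apply: val_inj; rewrite /= inordK; have := ltn_ord i; lia.
  apply: (iff_trans (rlazE N v)); apply: (iff_trans _ (iff_sym (rlazE N1 _))).
  split=> [lv|/laz1E[]//].
  apply/laz1E => //; split=> //.
  by have [|] := @laz_linear i.+1; first by have := ltn_ord i; lia.
Qed.

End RootExtension.

Lemma extension_root c (N : structure (LKV c)) (hN : models_T0 N) (a : N sK) :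
  exists (N1 : structure (LKV c)) (e : forall s, N s -> N1 s),
    [/\ models_T0 N1, embedding e & exists x, mulK x x = addK x (e sK a)].
Proof.
have [[z hz]|irr] := pselect (exists z, mulK z z = addK z a).
  by exists N, (fun _ z => z); split=> //; [exact: embedding_id|exists z].
have {}irr (z : scalars (T0_field hN)) : (z * z)%R <> (z + a)%R.
  by move=> E; apply: irr; exists z.
exists (root_extension hN a), (@root_extension_inj _ _ hN a); split.
- exact: root_extension_T0.
- exact: root_extension_embedding.
pose F := scalars (T0_field hN).
(* This pair is the adjoined [z]. *)
exists ((0, 1)%R : F * F).
change (root_extension_mul a (0, 1)%R (0, 1)%R = ((0, 1) + ((a : F), 0))%R :> F * F).
by rewrite /root_extension_mul; congr (_, _); rewrite /= ?mulr1 ?mul1r ?mulr0 ?mul0r ?add0r ?addr0.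
Qed.

(** * Extensions of models of [T_0] *)

Section LieTheoryFacts.
Variables (c : nat) (N : structure (LKV c)) (hN : models_T0 N).
Let fa := T0_field hN.
Let va := T0_vector_space hN.
Let F := scalars fa.
Let V := vectors fa va.

Lemma scaleK0 (v : N sV) : scale (zeroK N) v = zeroV N.
Proof. exact: (@scale0r F V v). Qed.

Lemma scaleV0 (a : N sK) : scale a (zeroV N) = zeroV N.
Proof. exact: (@scaler0 F V a). Qed.

Lemma laz_iter_bracket n j (t u : N sV) : 1 <= j -> j + n <= c.+1 ->
  laz j u -> laz (j + n) (iter n (bracket t) u).
Proof.
move=> j1; elim: n => [|n IH] /=; first by rewrite addn0.
rewrite addnS => jn /(IH (ltnW jn)) h.
rewrite -add1n; apply: (laz_bracket (T0_lazard hN)) => //; first lia.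
exact: (laz_first (T0_lazard hN)).
Qed.

Hypothesis hc : 2 <= c.

Lemma pairing_laz2_l (t v u : N sV) : laz 2 v -> pairing t v u = zeroV N.
Proof.
move=> lv; apply/(laz_last (T0_lazard hN)).
(* The weight count: [2] for [v], [1] for [u] and [1] for each of the [c - 2] copies of [t]. *)
have -> : c.+1 = 2 + (1 + (c - 2)) by lia.
apply: (laz_bracket (T0_lazard hN)); [lia|lia|done|].
apply: laz_iter_bracket => //; first lia.
exact: (laz_first (T0_lazard hN)).
Qed.

Lemma pairing_laz2_r (t v u : N sV) : laz 2 u -> pairing t v u = zeroV N.
Proof.
move=> lu; apply/(laz_last (T0_lazard hN)).
have -> : c.+1 = 1 + (2 + (c - 2)) by lia.
apply: (laz_bracket (T0_lazard hN)); [lia|lia| |].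
  exact: (laz_first (T0_lazard hN)).
by apply: laz_iter_bracket => //; lia.
Qed.

Lemma bracket_laz_last (v w : N sV) : laz c w -> bracket v w = zeroV N.
Proof.
move=> lw; apply/(laz_last (T0_lazard hN)); rewrite -add1n.
apply: (laz_bracket (T0_lazard hN)) => //; [lia|].
exact: (laz_first (T0_lazard hN)).
Qed.

Lemma lincomb2 (a : 'I_2 -> N sK) (p q : N sV) :
  lincomb a (fun i => if i == ord0 then p else q) =
  addV (scale (a ord0) p) (scale (a ord_max) q).
Proof.
rewrite (@lincombE c N fa va) big_ord_recl big_ord1 /=.
by congr (addV _ (scale (a _) _)); apply: val_inj.
Qed.

Lemma theta2_independent (p q : N sV) a :
  theta2 p q -> p <> scale a q /\ q <> scale a p.
Proof.
move=> /(thetaP (T0_coordinates hN)) ind.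
have oppK1 : oppK (oneK N) <> zeroK N.
  by move=> h; have := oner_neq0 F; rewrite -oppr_eq0 => /eqP; apply; exact: h.
split=> E; apply: oppK1.
- apply: (ind (fun i => if i == ord0 then oppK (oneK N) else a) _ ord0).
  rewrite lincomb2 /= -E.
  by apply: (etrans (congr1 (fun z => addV z p) (@scaleN1r F V p))); apply: (addNr (p : V)).
- apply: (ind (fun i => if i == ord0 then a else oppK (oneK N)) _ ord_max).
  rewrite lincomb2 /= -E.
  by apply: (etrans (congr1 (addV q) (@scaleN1r F V q))); apply: (addrN (q : V)).
Qed.

End LieTheoryFacts.

Section Scaling.
Variables (c : nat) (N : structure (LKV c)) (hN : models_T0 N).

Lemma iter_bracketZ n a (t u : N sV) :
  iter n (bracket t) (scale a u) = scale a (iter n (bracket t) u).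
Proof. by elim: n => //= n ->; rewrite (bracketZr (T0_lie hN)). Qed.

Lemma zero_grade1 : grade1_functional (fun _ : N sV => zeroK N).
Proof.
split=> // [_ _|a _]; first by rewrite (add0K (T0_field hN)).
exact: esym (@mulr0 (scalars (T0_field hN)) a).
Qed.

End Scaling.

(** The vectors are adjoined from the deepest Lazard level upwards, and [m <= c - 2] keeps the level
    at least [1]. The induction carries [k1] and the rule [[v, u] = k1(v) x], which are what
    [extension_vector] asks for at the next step. *)
Lemma extension_chain c (hc : 2 <= c) (N : structure (LKV c)) (hN : models_T0 N)
    (k : N sV -> N sK) (w : N sV) m :
  grade1_functional k -> laz c w -> m <= c - 2 ->
  exists (N1 : structure (LKV c)) (e : forall s, N s -> N1 s)
    (k1 : N1 sV -> N1 sK) (u x : N1 sV),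
    [/\ models_T0 N1, embedding e,
      grade1_functional k1 /\ (forall v, k1 (e sV v) = e sK (k v)),
      laz (c - 1 - m) u /\ (forall v, bracket v u = scale (k1 v) x)
    & forall t v, bracket (e sV v) (iter m (bracket (e sV t)) u) =
        e sV (scale (iter m (mulK (k t)) (k v)) w)].
Proof.
move=> kk lw; elim: m => [|m IH] hm.
  (* As [w] in [P_c] is central, its brackets have the required form with [y = 0]. *)
  have [||v|N1 [e [k1 [u [hN1 emb [kk1 k1e] [lu _ bu] _]]]]] :=
    @extension_vector c N hN (c - 1) k w (zeroV N) _ kk.
  - lia.
  - by have -> : (c - 1).+1 = c by lia.
  - by rewrite (bracket_laz_last hN hc) // (scaleV0 hN).
  exists N1, e, k1, u, (e sV w); split=> //; first by rewrite subn0.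
  by move=> t v /=; rewrite bu k1e (emb_scale emb).
have [|N1 [e1 [k1 [u [x [hN1 emb1 [kk1 k1e] [lu bu] iu]]]]]] := IH; first lia.
(* The last adjoined [u] now plays the role of [x], and its own [x] that of [y]. *)
have [||N2 [e2 [k2 [u2 [hN2 emb2 [kk2 k2e] [lu2 _ bu2] _]]]]] :=
    @extension_vector c N1 hN1 (c - 1 - m.+1) k1 u x _ kk1 _ bu.
- lia.
- by have -> : (c - 1 - m.+1).+1 = c - 1 - m by lia.
exists N2, (fun s z => e2 s (e1 s z)), k2, u2, (e2 sV u); split=> //.
- exact: embedding_comp emb1 emb2.
- by split=> // v; rewrite k2e k1e.
(* The innermost bracket turns [u2] into [k(t)] times the image of [u]; the scalar moves out, and
   the induction hypothesis treats the remaining brackets. *)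
move=> t v; rewrite iterSr bu2 k2e k1e (iter_bracketZ hN2) (bracketZr (T0_lie hN2)).
rewrite -(emb_iter_bracket emb2) -(emb_bracket emb2) iu -(emb_scale emb2) -(emb_scale emb1).
by rewrite (scaleA (T0_vector_space hN)).
Qed.

(** * Extensions that realize the pairing condition or a vector outside [P_2] *)

Section PairingExtension.
Variables (c : nat) (hc : 2 <= c) (N : structure (LKV c)) (hN : models_T0 N).
Let fa := T0_field hN.
Let va := T0_vector_space hN.
Let F := scalars fa.
Let V := vectors fa va.

Lemma laz2_linear_subspace : linear_subspace (fun v : V => laz 2 v).
Proof.
have [|s0 sD sZ] := laz_subspace (T0_lazard hN) (i := 2); first lia.
by split=> // a v w lv lw; apply: sD => //; apply: sZ.
Qed.

Lemma grade1_functionalP (k : V -> F) : linear_for *%R%R k ->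
  (forall v, laz 2 v -> k v = 0%R) -> grade1_functional (k : N sV -> N sK).
Proof.
move=> lin k2.
have k0 : k 0%R = 0%R by apply: k2; case: laz2_linear_subspace.
split=> // [v w|a v].
  by have := lin 1%R v w; rewrite scale1r mul1r.
by have := lin a v 0%R; rewrite k0 !addr0.
Qed.

(** Take [k] with [k t = 1] and [l] with [l v = 1]. If neither is nonzero at both vectors, then
    [k v = l t = 0] and [k + l] has the value [1] at both. *)
Lemma grade1_functional_exists (t v : V) : ~ laz 2 t -> ~ laz 2 v ->
  exists k : V -> F, [/\ linear_for *%R%R k, forall u, laz 2 u -> k u = 0%R,
    k t <> 0%R & k v <> 0%R].
Proof.
move=> nt nv.
have [k [k_lin k2 kt]] := separating_functional laz2_linear_subspace nt.
have [l [l_lin l2 lv]] := separating_functional laz2_linear_subspace nv.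
have n10 : (1 : F)%R <> 0%R by apply/eqP/oner_neq0.
have [kv|kv] := pselect (k v = 0%R); last by exists k; rewrite kt.
have [lt|lt] := pselect (l t = 0%R); last by exists l; rewrite lv.
exists (fun u => k u + l u)%R; rewrite kt kv lt lv add0r addr0; split=> //.
  by move=> a x y; rewrite k_lin l_lin mulrDr addrACA.
by move=> u l2u; rewrite k2 // l2 // addr0.
Qed.

(** The chain gives [pairing t v u] as [k(t)^(c-2) k(v)] times its end vector. Ending the chain at
    [a1^-1 w], with [a1] the coefficient for [v1], normalizes the first value to [w]; [b] is the
    ratio of the two coefficients. *)
Lemma extension_pairing (t v1 v2 w : N sV) : ~ laz 2 t -> ~ laz 2 v1 -> laz c w ->
  exists (N1 : structure (LKV c)) (e : forall s, N s -> N1 s),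
    [/\ models_T0 N1, embedding e &
     exists b u, pairing (e sV t) (e sV v1) u = e sV w /\
                 pairing (e sV t) (e sV v2) u = scale b (e sV w)].
Proof.
move=> nt nv1 lw.
have [k [k_lin k2 kt kv1]] := grade1_functional_exists nt nv1.
have coef v : iter (c - 2) (mulK (k t)) (k v) = (k t ^+ (c - 2) * k v)%R.
  elim: (c - 2) => [|n /= ->]; first by rewrite expr0 mul1r.
  by rewrite exprS -mulrA.
pose a1 : F := iter (c - 2) (mulK (k t)) (k v1).
have a10 : (a1 != 0)%R.
  by rewrite /a1 coef mulf_neq0 ?expf_neq0 //; apply/eqP.
have [_ _ lZ] := laz_subspace (T0_lazard hN) (i := c) ltac:(lia).
have [N1 [e [k1 [u [x [hN1 emb _ _ iu]]]]]] :=
  extension_chain hc hN (grade1_functionalP k_lin k2) (lZ (a1^-1)%R w lw) (leqnn _).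
exists N1, e; split=> //.
exists (e sK (mulK (iter (c - 2) (mulK (k t)) (k v2)) (a1^-1)%R)), u.
rewrite /pairing !iu (scaleA va) -(emb_scale emb) (scaleA va); split=> //.
congr (e sV _).
have -> : mulK (iter (c - 2) (mulK (k t)) (k v1)) (a1^-1)%R = oneK N by exact: (@mulfV F a1 a10).
exact: (scale1 va).
Qed.

(** With [k = 0] and [x = 0] at level [1], the adjoined vector is central and lies outside [P_2]. *)
Lemma extension_nonderived :
  exists (N1 : structure (LKV c)) (e : forall s, N s -> N1 s),
    [/\ models_T0 N1, embedding e & exists t : N1 sV, ~ laz 2 t].
Proof.
have [|||N1 [e [k1 [u [hN1 emb _ [_ nu _] _]]]]] :=
  @extension_vector c N hN 1 (fun=> zeroK N) (zeroV N) (zeroV N) _ (zero_grade1 hN).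
- lia.
- by case: laz2_linear_subspace.
- move=> v; rewrite (scaleK0 hN); apply: (bracket_laz_last hN hc).
  by have [|] := laz_subspace (T0_lazard hN) (i := c); first lia.
by exists N1, e; split=> //; exists u.
Qed.

End PairingExtension.

(** * Extensions with two independent vectors in [P_c] *)

Section PlaneExtension.
Variables (c : nat) (hc : 2 <= c).

Lemma extension_central (N : structure (LKV c)) : models_T0 N ->
  exists (N1 : structure (LKV c)) (e : forall s, N s -> N1 s) (u : N1 sV),
    [/\ models_T0 N1, embedding e, laz c u &
     (forall b, exists a, e sK a = b) /\ (forall b v, scale b u = e sV v -> b = zeroK N1)].
Proof.
move=> hN.
have lz i : 1 <= i <= c.+1 -> laz i (zeroV N).
  by move=> hi; case: (laz_subspace (T0_lazard hN) hi).
have [|||N1 [e [k1 [u [hN1 emb _ [lu _ _] ind]]]]] :=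
  @extension_vector c N hN c (fun=> zeroK N) (zeroV N) (zeroV N) _ (zero_grade1 hN).
- lia.
- by apply: lz; lia.
- move=> v; rewrite (scaleK0 hN); apply: (bracket_laz_last hN hc).
  by apply: lz; lia.
by exists N1, e, u.
Qed.

(** Two central vectors are adjoined in turn. In a relation between them the coefficient of [q]
    vanishes because [q] is independent from [N1]. That of [p], which comes from [N1] because the
    second step leaves the field unchanged, then vanishes because [p] is independent from [N]. *)
Lemma extension_plane (N : structure (LKV c)) : models_T0 N ->
  exists (N1 : structure (LKV c)) (e : forall s, N s -> N1 s),
    [/\ models_T0 N1, embedding e &
      exists p q : N1 sV, [/\ laz c p, laz c q & theta2 p q]].
Proof.
move=> hN.
have [N1 [e1 [p [hN1 emb1 lp [_ indp]]]]] := extension_central hN.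
have [N2 [e2 [q [hN2 emb2 lq [e2s indq]]]]] := extension_central hN1.
exists N2, (fun s z => e2 s (e1 s z)); split=> //; first exact: embedding_comp emb1 emb2.
exists (e2 sV p), q; split=> //; first by rewrite emb_laz.
apply/(thetaP (T0_coordinates hN2)) => a; rewrite (lincomb2 hN2) => E.
have [a0 E0] := e2s (a ord0).
pose F2 := scalars (T0_field hN2).
pose V2 := vectors (T0_field hN2) (T0_vector_space hN2).
pose F1 := scalars (T0_field hN1).
pose V1 := vectors (T0_field hN1) (T0_vector_space hN1).
have a1z : a ord_max = zeroK N2.
  apply: (indq _ (scale (oppK a0) p)).
  rewrite (emb_scale emb2) (emb_oppK emb2) E0.
  apply: (etrans _ (esym (@scaleNr F2 V2 (a ord0) (e2 sV p)))).
  by apply: (@addrI V2 (scale (a ord0) (e2 sV p))); rewrite addrN; exact: E.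
have a0z : a ord0 = zeroK N2.
  rewrite -E0 (indp a0 (zeroV N)) ?(emb_zeroK emb2) //.
  have [inj _ _] := emb2; apply: inj.
  rewrite (emb_scale emb2) (emb_zeroV emb1) (emb_zeroV emb2) E0.
  move: E; rewrite a1z (scaleK0 hN2) => E.
  exact: (etrans (esym (addr0 (scale (a ord0) (e2 sV p) : V2))) E).
move=> i; have [->|i0] := eqVneq i ord0; first exact: a0z.
suff -> : i = ord_max by exact: a1z.
by apply: val_inj; move: i i0 => [[|[]]].
Qed.

End PlaneExtension.

(** * Models of the model companion *)

Section ExistentiallyClosed.
Variables (c : nat) (T : theory (LKV c)) (hT : model_companion (@models_T0 c) T).

(** [N] embeds in a model [M'] of [T], where [P] still holds as it is preserved upwards. By model
    completeness the composite from [M] to [M'] is elementary, so [P] holds in [M]. *)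
Lemma existentially_closed (M N : structure (LKV c)) (e : forall s, M s -> N s) G
    (P : forall M' : structure (LKV c), tup M' G -> Prop) (v : tup M G) :
  models M T -> models_T0 N -> embedding e ->
  expressible P ->
  (forall (N1 N2 : structure (LKV c)) (f : forall s, N1 s -> N2 s) w,
     embedding f -> P N1 w -> P N2 (tmap f w)) ->
  P N (tmap e v) -> P M v.
Proof.
move=> mM mN emb [p pP] up PN.
have [into_T _ mc] := hT.
have [M' [e' [mM' emb']]] := into_T _ mN.
have el := mc _ _ _ mM mM' (embedding_comp emb emb').
by apply/pP/el/pP; apply: up emb' PN.
Qed.

(** The model companion hypothesis gives [M] an embedding into a model [N] of [T_0]. Universal
    conditions are pulled back from [N]; existential ones are realized in [N] or an extension of it
    and return through [existentially_closed]. *)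
Lemma model_rich (hc : 2 <= c) (M : structure (LKV c)) : models M T -> rich M.
Proof.
move=> mM; have [_ into_T0 _] := hT.
have [N [e [hN emb]]] := into_T0 _ mM.
have [inj _ _] := emb; have iV := inj sV; have iK := inj sK.
have [[[fa va] lie] lz] := (T0_field hN, T0_vector_space hN, T0_lie hN, T0_lazard hN).
pose ee := (emb_zeroV emb, emb_zeroK emb, emb_oneK emb, emb_addV emb, emb_subV emb,
  emb_addK emb, emb_mulK emb, emb_oppK emb, emb_scale emb, emb_bracket emb,
  emb_pairing emb).
split.
- split.
  + by move=> x y z; apply: iK; rewrite !ee (addKA fa).
  + by move=> x y; apply: iK; rewrite !ee (addKC fa).
  + by move=> x; apply: iK; rewrite !ee (add0K fa).
  + by move=> x; apply: iK; rewrite !ee (addNK fa).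
  + by move=> x y z; apply: iK; rewrite !ee (mulKA fa).
  + by move=> x y; apply: iK; rewrite !ee (mulKC fa).
  + by move=> x; apply: iK; rewrite !ee (mul1K fa).
  + by move=> x y z; apply: iK; rewrite !ee (mulKDl fa).
  + by move=> /(congr1 (e sK)); rewrite !ee; apply: oneK_neq0 fa.
  + move=> a a0.
    (* The language has no symbol for the inverse, so an inverse found in [N] returns to [M] by
       existential closedness. *)
    pose P (M' : structure (LKV c)) (v : tup M' (cext (cnil lsort) sK)) :=
      exists b, mulK b (v None) = oneK M'.
    apply: (@existentially_closed _ _ e _ P (text (@tnil _ M) a) mM hN emb).
    * by do ![express_rich].
    * move=> N1 N2 f w ef [b E]; exists (f sK b).
      by rewrite -(emb_mulK ef) E (emb_oneK ef).
    * by apply: (mulVK fa) => /= E; apply: a0; apply: iK; rewrite ee.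
- split.
  + by move=> x y z; apply: iV; rewrite !ee (addVA va).
  + by move=> x y; apply: iV; rewrite !ee (addVC va).
  + by move=> x; apply: iV; rewrite !ee (add0V va).
  + by move=> x y; apply: iV; rewrite !ee (subVK va).
  + by move=> a b x; apply: iV; rewrite !ee (scaleA va).
  + by move=> x; apply: iV; rewrite !ee (scale1 va).
  + by move=> a x y; apply: iV; rewrite !ee (scaleDr va).
  + by move=> a b x; apply: iV; rewrite !ee (scaleDl va).
- move=> a; have [N1 [e1 [hN1 emb1 ex]]] := extension_root hN (e sK a).
  pose P (M' : structure (LKV c)) (v : tup M' (cext (cnil lsort) sK)) :=
    exists x, mulK x x = addK x (v None).
  apply: (@existentially_closed _ _ _ _ P (text (@tnil _ M) a) mM hN1 (embedding_comp emb emb1)).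
  + by do ![express_rich].
  + move=> N2 N3 f w ef [x E]; exists (f sK x).
    by rewrite -(emb_mulK ef) E (emb_addK ef).
  + exact: ex.
- by move=> u v w; apply: iV; rewrite !ee (bracketDl lie).
- by move=> u v w; apply: iV; rewrite !ee (bracketDr lie).
- by move=> a v w; apply: iV; rewrite !ee (bracketZl lie).
- by move=> a v w; apply: iV; rewrite !ee (bracketZr lie).
- have [|l0 lD lZ] := laz_subspace lz (i := 2); first lia.
  split.
  + by apply/(emb_laz emb); rewrite ee.
  + by move=> v w /(emb_laz emb) lv /(emb_laz emb) lw; apply/(emb_laz emb); rewrite ee; apply: lD.
  + by move=> a v /(emb_laz emb) lv; apply/(emb_laz emb); rewrite ee; apply: lZ.
- by move=> t v u /(emb_laz emb) lv; apply: iV; rewrite !ee (pairing_laz2_l hN hc).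
- by move=> t v u /(emb_laz emb) lv; apply: iV; rewrite !ee (pairing_laz2_r hN hc).
- have [N1 [e1 [hN1 emb1 ex]]] := extension_nonderived hc hN.
  pose P (M' : structure (LKV c)) (v : tup M' (cnil lsort)) := exists t : M' sV, ~ laz 2 t.
  apply: (@existentially_closed _ _ _ _ P (@tnil _ M) mM hN1 (embedding_comp emb emb1)).
  + by do ![express_rich].
  + by move=> N2 N3 f w ef [x nx]; exists (f sV x) => /(emb_laz ef).
  + exact: ex.
- have [N1 [e1 [hN1 emb1 ex]]] := extension_plane hc hN.
  pose P (M' : structure (LKV c)) (v : tup M' (cnil lsort)) :=
    exists p q : M' sV, laz c p /\ laz c q /\ theta2 p q.
  have [|||p [q [lp [lq th]]]] :=
    @existentially_closed _ _ _ _ P (@tnil _ M) mM hN1 (embedding_comp emb emb1).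
  + by do ![express_rich].
  + move=> N2 N3 f w ef [p [q [lp [lq th]]]]; exists (f sV p), (f sV q).
    by rewrite !(emb_laz ef) (emb_theta2 ef).
  + by have [p [q [lp lq th]]] := ex; exists p, q.
  by exists p, q.
- move=> p q a /(emb_theta2 emb) /(theta2_independent hN (e sK a)) [pq qp].
  by split=> /(congr1 (e sV)); rewrite ee.
- move=> t v1 v2 w nt nv1 lw.
  have [|||N1 [e1 [hN1 emb1 ex]]] :=
    @extension_pairing c hc N hN (e sV t) (e sV v1) (e sV v2) (e sV w).
  + by move=> /(emb_laz emb).
  + by move=> /(emb_laz emb).
  + exact/(emb_laz emb).
  pose P (M' : structure (LKV c))
      (v : tup M' (cext (cext (cext (cext (cnil lsort) sV) sV) sV) sV)) :=
    exists b u, pairing (v (Some (Some (Some None)))) (v (Some (Some None))) u = v None /\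
      pairing (v (Some (Some (Some None)))) (v (Some None)) u = scale b (v None).
  apply: (@existentially_closed _ _ _ _ P
    (@text _ M _ sV (@text _ M _ sV (@text _ M _ sV (@text _ M _ sV (@tnil _ M) t) v1) v2) w)
    mM hN1 (embedding_comp emb emb1)).
  + by do ![express_rich].
  + move=> N2 N3 f x ef [b [u [E1 E2]]]; exists (f sK b), (f sV u).
    by rewrite -!(emb_pairing ef) E1 E2 (emb_scale ef).
  + exact: ex.
Qed.
End ExistentiallyClosed.

(** Convergence of truth values is applied to a sentence, with the empty tuple. The elementary map
    then takes it to the saturated structure in which the Morley rank is computed. *)
Lemma rich_not_approximable c (M : structure (LKV c)) :
  rich M -> ~ approximable_by_fmr M.
Proof.
move=> rM [H [apx fmr]].
have [p pP] := expressible_rich c.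
have [N [HN hN evN]] := approx_truth apx ((pP M (@tnil _ M)).2 rM).
have /pP rN := evN N hN HN (fun _ _ h => h).
have [N' [e [ele _ /(_ sV)[n]]]] := fmr N HN; apply.
apply: rich_rank; apply/(pP N' (tmap e (lift hN))).
by apply/ele/pP.
Qed.

Theorem corollary4p9 (c : nat) (hc : 2 <= c) (T : theory (LKV c))
    (hT : model_companion (@models_T0 c) T) :
  forall M : structure (LKV c), models M T -> ~ approximable_by_fmr M.
Proof. by move=> M /(model_rich hT hc); apply: rich_not_approximable. Qed.
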